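(* Let $[\mathcal{A},\|\cdot\|_{\mathcal{A}}]$ and $[\mathcal{I},\|\cdot\|_{\mathcal{I}}]$ be normed operator ideals, and let $[\mathcal{I}^{\mathcal{H}_v^\infty},\|\cdot\|_{\mathcal{I}^{\mathcal{H}_v^\infty}}]$ be a normed weighted holomorphic ideal with the linearization property (LP) in $\mathcal{I}$. Then $$[\mathcal{A}^{-1}\circ\mathcal{I}^{\mathcal{H}_v^\infty},\|\cdot\|_{\mathcal{A}^{-1}\circ\mathcal{I}^{\mathcal{H}_v^\infty}}]=[(\mathcal{A}^{-1}\circ\mathcal{I})\circ\mathcal{H}_v^\infty,\|\cdot\|_{(\mathcal{A}^{-1}\circ\mathcal{I})\circ\mathcal{H}_v^\infty}].$$
   Context: All Banach spaces are complex. A weight $v$ on an open subset $U$ of a Banach space $E$ is a strictly positive continuous function on $U$; whenever an open set $U$ is considered, it carries a weight denoted $v$ (open subsets of $U$ carry the restriction). $\mathcal{H}_v^\infty(U,F)$ is the Banach space of holomorphic $f:U\to F$ with $\|f\|_v:=\sup_{x\in U}v(x)\|f(x)\|<\infty$, and $\mathcal{H}_v^\infty(U)=\mathcal{H}_v^\infty(U,\mathbb{C})$. Linearization: $\mathcal{G}_v^\infty(U)\subset\mathcal{H}_v^\infty(U)^*$ is the canonical predual of $\mathcal{H}_v^\infty(U)$, the norm-closed linear span of the evaluations $\delta_x$, $\delta_x(f)=f(x)$, $x\in U$. The map $\Delta_v:U\to\mathcal{G}_v^\infty(U)$, $\Delta_v(x)=\delta_x$, belongs to $\mathcal{H}_v^\infty(U,\mathcal{G}_v^\infty(U))$,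 and for every $f\in\mathcal{H}_v^\infty(U,F)$ there is a unique $T_f\in\mathcal{L}(\mathcal{G}_v^\infty(U),F)$ with $T_f\circ\Delta_v=f$; moreover $\|T_f\|=\|f\|_v$. A normed (Banach) weighted holomorphic ideal $[\mathcal{I}^{\mathcal{H}_v^\infty},\|\cdot\|_{\mathcal{I}^{\mathcal{H}_v^\infty}}]$ assigns to every pair $(U,F)$ ($U$ open in a Banach space $E$, $F$ a Banach space) a set $\mathcal{I}^{\mathcal{H}_v^\infty}(U,F)\subseteq\mathcal{H}_v^\infty(U,F)$ and a function $\|\cdot\|_{\mathcal{I}^{\mathcal{H}_v^\infty}}$ on it such that: (P1) it is a normed (Banach) space and $\|f\|_{\mathcal{I}^{\mathcal{H}_v^\infty}}\ge\|f\|_v$; (P2) for $h\in\mathcal{H}_v^\infty(U)$, $y\in F$, the map $h\cdot y:x\mapsto h(x)y$ belongs to it with norm $\|h\|_v\|y\|$; (P3) if $V\subseteq U$ is open in $E$, $h:V\to U$ is holomorphic with $c_v(h):=\sup_{x\in V}v(x)/v(h(x))<\infty$, $f\in\mathcal{I}^{\mathcal{H}_v^\infty}(U,F)$ and $T\in\mathcal{L}(F,G)$, then $T\circ f\circ h\in\mathcal{I}^{\mathcal{H}_v^\infty}(V,G)$ with norm at most $\|T\|\,\|f\|_{\mathcal{I}^{\mathcal{H}_v^\infty}}c_v(h)$. Normed operator ideals are understood in the usual sense of Pietsch. LP: $\mathcal{I}^{\mathcal{H}_v^\infty}$ has the linearization property in an operator ideal $\mathcal{I}$ if for every $f\in\mathcal{H}_v^\infty(U,F)$: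 $f\in\mathcal{I}^{\mathcal{H}_v^\infty}(U,F)$ iff $T_f\in\mathcal{I}(\mathcal{G}_v^\infty(U),F)$, and in that case $\|f\|_{\mathcal{I}^{\mathcal{H}_v^\infty}}=\|T_f\|_{\mathcal{I}}$. Left-hand quotients: $\mathcal{A}^{-1}\circ\mathcal{I}(E,F)$ is the set of $T\in\mathcal{L}(E,F)$ such that $A\circ T\in\mathcal{I}(E,G)$ for every Banach space $G$ and every $A\in\mathcal{A}(F,G)$, with norm $\|T\|_{\mathcal{A}^{-1}\circ\mathcal{I}}=\sup\{\|A\circ T\|_{\mathcal{I}}:A\in\mathcal{A}(F,G),\ \|A\|_{\mathcal{A}}\le1\}$, $G$ ranging over all Banach spaces. Likewise $\mathcal{A}^{-1}\circ\mathcal{I}^{\mathcal{H}_v^\infty}(U,F)$ is the set of $f\in\mathcal{H}_v^\infty(U,F)$ such that $A\circ f\in\mathcal{I}^{\mathcal{H}_v^\infty}(U,G)$ for all such $G$, $A$, with norm $\sup\{\|A\circ f\|_{\mathcal{I}^{\mathcal{H}_v^\infty}}:\|A\|_{\mathcal{A}}\le1\}$. Composition ideal: for an operator ideal $\mathcal{B}$, $f\in\mathcal{B}\circ\mathcal{H}_v^\infty(U,F)$ if $f=B\circ g$ for some Banach space $G$, $B\in\mathcal{B}(G,F)$, $g\in\mathcal{H}_v^\infty(U,G)$; $\|f\|_{\mathcal{B}\circ\mathcal{H}_v^\infty}:=\inf\|B\|_{\mathcal{B}}\|g\|_v$ over all such factorizations. Equality of ideals means equality of the sets for all $(U,F)$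 and of the norms. *)

(* Defs.v *)
From HB Require Import structures.
From mathcomp Require Import all_boot all_order all_algebra.
From mathcomp Require Import all_classical all_reals all_analysis.
From mathcomp Require Import complex.

Set Implicit Arguments.
Unset Strict Implicit.
Unset Printing Implicit Defensive.

Import Order.TTheory GRing.Theory Num.Theory.
Import numFieldNormedType.Exports.

Local Open Scope classical_set_scope.
Local Open Scope ring_scope.
Local Open Scope complex_scope.

(* The library norm of a normedModType R[i] takes its values in R[i]; nrm is
   the same norm with values in R (see nrmE). *)
Definition nrm (R : realType) (V : normedModType R[i]) (x : V) : R :=
  complex.Re `|x|.

Section nrm_theory.
Context {R : realType} {V : normedModType R[i]}.
Implicit Types x y : V.

Lemma nrmE x : (nrm x)%:C = `|x|.
Proof. by apply: RRe_real; exact: normr_real. Qed.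

Lemma nrm_le x (r : R) : (nrm x <= r) = (`|x| <= r%:C).
Proof. by rewrite -nrmE lecR. Qed.

Lemma nrm_lt x (r : R) : (nrm x < r) = (`|x| < r%:C).
Proof. by rewrite -nrmE ltcR. Qed.

Lemma nrm_ge0 x : 0 <= nrm x.
Proof. by rewrite -lecR nrmE normr_ge0. Qed.

Lemma nrmD x y : nrm (x + y) <= nrm x + nrm y.
Proof. by rewrite -lecR rmorphD/= !nrmE ler_normD. Qed.

Lemma nrm0 : nrm (0 : V) = 0.
Proof. by rewrite /nrm normr0. Qed.

Lemma nrm0_eq0 x : nrm x = 0 -> x = 0.
Proof. by move=> x0; apply: normr0_eq0; rewrite -nrmE x0. Qed.

Lemma nrmN x : nrm (- x) = nrm x.
Proof. by rewrite /nrm normrN. Qed.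

Lemma nrmB x y : nrm (x - y) = nrm (y - x).
Proof. by rewrite /nrm distrC. Qed.

Lemma nrmZ (a : R[i]) x : nrm (a *: x) = nrm (a : R[i]^o) * nrm x.
Proof.
apply: (@complexI R); rewrite rmorphM/= !nrmE normrZ.
by congr (_ * _); rewrite -nrmE.
Qed.

End nrm_theory.

(* The Banach space of scalars.  It needs a name of its own: the completeness
   instance on R^o is already taken by the real case. *)
Definition cplx (R : realType) : Type := R[i]^o.
HB.instance Definition _ (R : realType) := NormedModule.copy (cplx R) R[i]^o.

Section complete_tools.
Context {R : realType}.

Lemma complex_e2 (e : R[i]) : 0 < e -> exists2 d : R, 0 < d & d%:C = e.
Proof.
move=> e0; have er : e \is Num.real by exact: gtr0_real.
by exists (complex.Re e); [rewrite -ltcR|]; rewrite RRe_real.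
Qed.

Lemma nrm_cauchy (V : normedModType R[i]) (F : set_system V) :
  ProperFilter F -> cauchy F <->
  forall d : R, 0 < d -> exists x, F [set y | nrm (x - y) < d].
Proof.
move=> FF; split=> [/cauchyP Fc d d0|Fc].
  have d0' : 0 < d%:C by rewrite ltcR.
  have [x] := Fc _ d0'; rewrite -ball_normE => Fx; exists x.
  by apply: filterS Fx => y /=; rewrite nrm_lt.
apply/cauchyP => e /complex_e2[d d0 <-].
have [x Fx] := Fc _ d0; exists x; rewrite -ball_normE.
by apply: filterS Fx => y /=; rewrite nrm_lt.
Qed.

Lemma nrm_cvg (V : normedModType R[i]) (F : set_system V) (l : V) :
  ProperFilter F -> (F --> l) <->
  forall d : R, 0 < d -> F [set y | nrm (l - y) < d].
Proof.
move=> FF; split=> [/cvgrPdist_lt Fl d d0|Fl].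
  have d0' : 0 < d%:C by rewrite ltcR.
  by apply: filterS (Fl _ d0') => y /=; rewrite nrm_lt.
apply/cvgrPdist_lt => e /complex_e2[d d0 <-].
by apply: filterS (Fl _ d0) => y /=; rewrite nrm_lt.
Qed.

Lemma nrm_closure (V : normedModType R[i]) (A : set V) (l : V) :
  closure A l <-> forall d : R, 0 < d -> exists2 y, A y & nrm (l - y) < d.
Proof.
split=> [cA d d0|cA B].
  have d0' : 0 < d%:C by rewrite ltcR.
  have [y [Ay]] := cA _ (nbhsx_ballx l d%:C d0').
  by rewrite -ball_normE => ly; exists y => //; rewrite nrm_lt.
move=> /nbhs_ballP[e /= /complex_e2[d d0 <-]] lB.
have [y Ay ly] := cA _ d0; exists y; split=> //; apply: lB.
by rewrite -ball_normE /= -nrm_lt.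
Qed.

Lemma complex_complete (F : set_system (cplx R)) :
  ProperFilter F -> cauchy F -> cvg F.
Proof.
move=> FF /nrm_cauchy Fc.
have nRe (z : cplx R) : `|complex.Re z| <= nrm z.
  by rewrite -lecR nrmE; exact: normc_ge_Re.
have nIm (z : cplx R) : `|complex.Im z| <= nrm z.
  rewrite -lecR nrmE normc_def lecR -sqrtr_sqr ler_sqrt.
    by rewrite lerDr sqr_ge0.
  by rewrite addr_ge0 ?sqr_ge0.
have nle (z : cplx R) : nrm z <= `|complex.Re z| + `|complex.Im z|.
  rewrite {1}[z](complexE z).
  apply: le_trans (nrmD _ _) _; apply: lerD.
    by rewrite -lecR nrmE normc_def /= expr0n addr0 sqrtr_sqr.
  rewrite -lecR nrmE normrM !normc_def/=.
  by rewrite expr0n expr1n add0r addr0 sqrtr1 sqrtr_sqr mul1r.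
pose pRe (z : cplx R) : R := complex.Re z.
pose pIm (z : cplx R) : R := complex.Im z.
have pReB x y : pRe (x - y) = pRe x - pRe y by case: x y => [? ?] [].
have pImB x y : pIm (x - y) = pIm x - pIm y by case: x y => [? ?] [].
have cRe : cvg (pRe @ F).
  apply: cauchy_cvg; apply/cauchyP => d d0.
  have [x Fx] := Fc _ d0; exists (pRe x).
  suff: F (pRe @^-1` ball (pRe x) d) by [].
  apply: filterS Fx => y xy; rewrite -ball_normE /=.
  by apply: le_lt_trans xy; rewrite -pReB; exact: nRe.
have cIm : cvg (pIm @ F).
  apply: cauchy_cvg; apply/cauchyP => d d0.
  have [x Fx] := Fc _ d0; exists (pIm x).
  suff: F (pIm @^-1` ball (pIm x) d) by [].
  apply: filterS Fx => y xy; rewrite -ball_normE /=.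
  by apply: le_lt_trans xy; rewrite -pImB; exact: nIm.
apply/cvg_ex; exists (lim (pRe @ F) +i* lim (pIm @ F)).
apply/nrm_cvg => d d0; have d20 : 0 < d / 2 by rewrite divr_gt0.
move/cvgrPdist_lt : cRe => /(_ _ d20) HR.
move/cvgrPdist_lt : cIm => /(_ _ d20) HI.
apply: filterS2 HR HI => z /= zR zI.
apply: le_lt_trans (nle _) _; rewrite [d]splitr; apply: ltrD.
  by rewrite -/(pRe _) pReB.
by rewrite -/(pIm _) pImB.
Qed.

End complete_tools.

HB.instance Definition _ (R : realType) :=
  Uniform_isComplete.Build (cplx R) (@complex_complete R).

(* L(E, F): continuous linear maps, later given the operator norm. *)
Definition bop_pred (R : realType) (E F : normedModType R[i]) :
  {pred E -> F} := fun f => `[< linear f /\ continuous f >].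
Arguments bop_pred {R} E F.

Record bop (R : realType) (E F : normedModType R[i]) := Bop {
  bop_fun :> E -> F;
  bopP : bop_fun \in bop_pred E F }.

Section bop_lmodule.
Context {R : realType} {E F : normedModType R[i]}.

Lemma bop_submod_closed : submod_closed (bop_pred E F).
Proof.
split=> [|a f g /asboolP[lf cf] /asboolP[lg cg]].
  apply/asboolP; split=> [a x y|x]; first by rewrite scaler0 addr0.
  exact: cvg_cst.
apply/asboolP; split=> [b x y|x].
  rewrite !fctE lf lg !scalerDr !scalerA addrACA; congr (_ + _ + _).
  by rewrite mulrC.
apply: cvgD; last exact: cg.
by apply: cvgZr; exact: cf.
Qed.

HB.instance Definition _ :=
  GRing.isSubmodClosed.Build _ _ (bop_pred E F) bop_submod_closed.
HB.instance Definition _ := [isSub for @bop_fun R E F].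
HB.instance Definition _ := [Choice of bop E F by <:].
HB.instance Definition _ := [SubChoice_isSubLmodule of bop E F by <:].

Implicit Types T S : bop E F.

Lemma bopE f (fP : f \in bop_pred E F) x : Bop fP x = f x.
Proof. by []. Qed.

Lemma bop_ext T S : T =1 S -> T = S.
Proof. by move=> TS; apply/val_inj/funext. Qed.

Lemma bop_linear T : linear T.
Proof. by have /asboolP[] := bopP T. Qed.

Lemma bop_continuous T : continuous T.
Proof. by have /asboolP[] := bopP T. Qed.

Lemma bopD T S x : (T + S) x = T x + S x.
Proof. by []. Qed.

Lemma bopZ (a : R[i]) T x : (a *: T) x = a *: T x.
Proof. by []. Qed.

Lemma bop0 x : (0 : bop E F) x = 0.
Proof. by []. Qed.

HB.instance Definition _ T :=
  GRing.isLinear.Build R[i] E F _ (bop_fun T) (bop_linear T).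

Definition opnorm T : R := sup [set nrm (T x) | x in [set x | nrm x <= 1]].

Lemma bop_bounded T : exists2 M : R, 0 <= M & forall x, nrm (T x) <= M * nrm x.
Proof.
have /continuous_linear_bounded/linear_boundedP : {for 0, continuous T}.
  exact: bop_continuous.
case=> M [Mr MT]; have M1 : M < `|M| + 1.
  by rewrite (le_lt_trans (real_ler_norm Mr))// ltrDl.
exists (nrm (M : R[i]^o) + 1); first by rewrite addr_ge0 ?nrm_ge0.
move=> x; rewrite nrm_le rmorphM/= rmorphD/= !nrmE.
exact: MT.
Qed.

Lemma opnormP T x : nrm (T x) <= opnorm T * nrm x.
Proof.
have [M M0 TM] := bop_bounded T.
have [->|x0] := eqVneq x 0; first by rewrite linear0 !nrm0 mulr0.
have nx0 : 0 < nrm x.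
  rewrite lt_neqAle nrm_ge0 andbT eq_sym.
  by apply: contraNneq x0 => /nrm0_eq0 ->.
rewrite -ler_pdivrMr//; apply: sup_upper_bound.
  split; first by exists (nrm (T 0)), 0 => //=; rewrite nrm0.
  exists M => _ [y /= y1 <-]; apply: le_trans (TM y) _.
  by rewrite -[leRHS]mulr1 ler_wpM2l.
have nV : nrm ((nrm x)^-1%:C : R[i]^o) = (nrm x)^-1.
  apply: (@complexI R); rewrite nrmE ger0_norm// lecR invr_ge0.
  exact: nrm_ge0.
exists ((nrm x)^-1%:C *: x).
  by rewrite /= nrmZ nV mulVf// gt_eqF.
by rewrite linearZ/= nrmZ nV mulrC.
Qed.

Lemma opnorm_ge0 T : 0 <= opnorm T.
Proof.
have [M M0 TM] := bop_bounded T.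
apply: le_trans (nrm_ge0 (T 0)) _; apply: sup_upper_bound.
  split; first by exists (nrm (T 0)), 0 => //=; rewrite nrm0.
  exists M => _ [y /= y1 <-]; apply: le_trans (TM y) _.
  by rewrite -[leRHS]mulr1 ler_wpM2l.
by exists 0 => //=; rewrite nrm0.
Qed.

Lemma opnorm_le T (M : R) :
  0 <= M -> (forall x, nrm (T x) <= M * nrm x) -> opnorm T <= M.
Proof.
move=> M0 TM; apply: ge_sup.
  by exists (nrm (T 0)), 0 => //=; rewrite nrm0.
move=> _ [y /= y1 <-]; apply: le_trans (TM y) _.
by rewrite -[leRHS]mulr1 ler_wpM2l.
Qed.

Lemma opnormD T S : (opnorm (T + S))%:C <= (opnorm T)%:C + (opnorm S)%:C.
Proof.
rewrite -rmorphD lecR opnorm_le ?addr_ge0 ?opnorm_ge0// => x.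
by rewrite bopD mulrDl (le_trans (nrmD _ _))// lerD// opnormP.
Qed.

Lemma opnormZ (a : R[i]) T : (opnorm (a *: T))%:C = `|a| * (opnorm T)%:C.
Proof.
have le b S : opnorm (b *: S) <= nrm (b : R[i]^o) * opnorm S.
  rewrite opnorm_le ?mulr_ge0 ?nrm_ge0 ?opnorm_ge0// => x.
  by rewrite bopZ nrmZ -mulrA ler_wpM2l ?nrm_ge0 ?opnormP.
have nE : (nrm (a : R[i]^o))%:C = `|a| by rewrite nrmE.
rewrite -nE -rmorphM/=; congr (_%:C); apply/eqP; rewrite eq_le le/=.
have [->|a0] := eqVneq a 0; first by rewrite nrm0 mul0r opnorm_ge0.
have na0 : 0 < nrm (a : R[i]^o) by rewrite -ltcR nE normr_gt0.
rewrite mulrC -ler_pdivlMr//.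
have := le a^-1 (a *: T); rewrite scalerA mulVf// scale1r => /le_trans; apply.
rewrite mulrC ler_wpM2l ?opnorm_ge0//.
by rewrite -lecR nrmE normfV -nE fmorphV.
Qed.

Lemma opnorm_eq0 T : (opnorm T)%:C = 0 -> T = 0.
Proof.
move/complexI => T0; apply: bop_ext => x; apply: nrm0_eq0; apply/eqP.
by rewrite eq_le nrm_ge0 andbT (le_trans (opnormP T x))// T0 mul0r.
Qed.

HB.instance Definition _ :=
  @Lmodule_isNormed.Build R[i] (bop E F) (fun T => (opnorm T)%:C)
    opnormD opnormZ opnorm_eq0.

Lemma nrm_bop T : nrm T = opnorm T.
Proof. by []. Qed.

End bop_lmodule.

Section bop_complete.
Context {R : realType} {E : normedModType R[i]}.
Context {F : completeNormedModType R[i]}.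

Lemma bop_complete (H : set_system (bop E F)) :
  ProperFilter H -> cauchy H -> cvg H.
Proof.
move=> HH /nrm_cauchy Hc.
have evB (T S : bop E F) x : nrm (T x - S x) <= nrm (T - S) * nrm x.
  by rewrite nrm_bop; exact: (opnormP (T - S)).
pose ev x := (fun T : bop E F => T x) @ H.
have evc x : cvg (ev x).
  apply: cauchy_cvg; apply/nrm_cauchy => d d0.
  have x1 : 0 < nrm x + 1 by rewrite ltr_wpDl ?nrm_ge0.
  have [T HT] := Hc (d / (nrm x + 1)) (divr_gt0 d0 x1).
  exists (T x).
  suff : H [set S : bop E F | nrm (T x - S x) < d] by [].
  apply: filterS HT => S /= TS; apply: le_lt_trans (evB _ _ _) _.
  move: TS; rewrite ltr_pdivlMr//; apply: le_lt_trans.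
  by rewrite ler_wpM2l ?nrm_ge0// lerDl.
pose l x := lim (ev x).
have evl x (d : R) : 0 < d -> H [set T : bop E F | nrm (l x - T x) < d].
  by move=> d0; have /nrm_cvg/(_ _ d0) := evc x.
have llin : linear l.
  move=> a x y; apply/eqP; rewrite -subr_eq0; apply/eqP/nrm0_eq0/eqP.
  rewrite eq_le nrm_ge0 andbT; apply/ler_addgt0Pl => e e0; rewrite addr0.
  pose k : R := nrm (a : R[i]^o) + 2.
  have k0 : 0 < k by rewrite ltr_wpDl ?nrm_ge0.
  have ek : 0 < e / k by rewrite divr_gt0.
  have [T [[/= T1 T2] T3]] := filter_ex (filterI (filterI
    (evl (a *: x + y) _ ek) (evl x _ ek)) (evl y _ ek)).
  have -> : l (a *: x + y) - (a *: l x + l y) =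
    (l (a *: x + y) - T (a *: x + y)) - a *: (l x - T x) - (l y - T y).
    rewrite (bop_linear T) scalerBr -[RHS]addrA -opprD -[RHS]addrA -opprD.
    by rewrite [X in _ = _ - (_ + X)]addrACA -opprD subrKC.
  apply: le_trans (nrmD _ _) _; rewrite nrmN.
  apply: le_trans (lerD (nrmD _ _) (lexx _)) _; rewrite nrmN nrmZ.
  have -> : e = e / k + nrm (a : R[i]^o) * (e / k) + e / k.
    by rewrite -[X in X + _ + _]mul1r -[X in _ + _ + X]mul1r -!mulrDl;
       rewrite addrAC addrC -[1 + 1]/2 -/k mulrC divfK// gt_eqF.
  by rewrite !lerD// ?ler_wpM2l ?nrm_ge0// ltW.
have lB T (d : R) : H [set S : bop E F | nrm (T - S) < d] ->
    forall x, nrm (l x - T x) <= d * nrm x.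
  move=> HT x; apply/ler_addgt0Pl => e e0.
  have [S [/= TS Sl]] := filter_ex (filterI HT (evl x _ e0)).
  rewrite -(subrKA (S x)) (le_trans (nrmD _ _))// lerD//; first exact: ltW.
  rewrite nrmB (le_trans (evB _ _ _))// ler_wpM2r ?nrm_ge0//; exact: ltW.
have [T HT] := Hc 1 ltr01.
pose lL : {linear E -> F} := HB.pack l (GRing.isLinear.Build R[i] E F _ l llin).
have lcont : continuous l.
  suff : continuous lL by [].
  apply: bounded_linear_continuous; apply/linear_boundedP.
  exists (opnorm T + 1)%:C; split.
    by apply/complex_realP; eexists.
  move=> M TM x; rewrite -[lL x]/(l x) -nrmE; apply: (@le_trans _ _
    ((opnorm T + 1)%:C * `|x|)); last by rewrite ler_wpM2r// ltW.
  rewrite -nrmE -rmorphM lecR mulrDl mul1r addrC -(subrK (T x) (l x)).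
  rewrite (le_trans (nrmD _ _))// lerD ?opnormP//.
  by rewrite -[leRHS]mul1r lB.
have lP : l \in bop_pred E F by apply/asboolP.
apply/cvg_ex; exists (Bop lP); apply/nrm_cvg => d d0.
have d20 : 0 < d / 2 / 2 by rewrite !divr_gt0.
have [S HS] := Hc _ d20; apply: filterS (HS) => S' /= SS'.
apply: (@le_lt_trans _ _ (d / 2)); last by rewrite ltr_pdivrMr// ltr_pMr// ltr1n.
rewrite nrm_bop opnorm_le ?divr_ge0// ?ltW// => x.
rewrite [d / 2]splitr mulrDl; apply: le_trans (_ : nrm ((l x - S x) + (S x - S' x)) <= _).
  by rewrite subrKA.
rewrite (le_trans (nrmD _ _))// lerD ?lB// (le_trans (evB _ _ _))//.
by rewrite ler_wpM2r ?nrm_ge0// ltW.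
Qed.

HB.instance Definition _ := Uniform_isComplete.Build (bop E F) bop_complete.

End bop_complete.

Section bop_category.
Context {R : realType}.
Implicit Types E F G : normedModType R[i].

Lemma bop_id_subproof E : (id : E -> E) \in bop_pred E E.
Proof. by apply/asboolP; split=> // x; exact: cvg_id. Qed.

Definition bop_id E : bop E E := Bop (bop_id_subproof E).

Lemma bop_comp_subproof E F G (S : bop F G) (T : bop E F) :
  S \o T \in bop_pred E G.
Proof.
apply/asboolP; split=> [a x y|x] /=; first by rewrite !linearP.
by apply: continuous_comp; exact: bop_continuous.
Qed.

Definition bop_comp E F G (S : bop F G) (T : bop E F) : bop E G :=
  Bop (bop_comp_subproof S T).

End bop_category.

Arguments bop_id {R} E.

(* The norm-closed linear span of A, as a Banach space. *)
Section closed_span.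
Context {R : realType}.

Definition linear_span (X : normedModType R[i]) (A : set X) : set X :=
  [set x | exists n (c : 'I_n -> R[i]) (a : 'I_n -> X),
    (forall i, A (a i)) /\ x = \sum_(i < n) c i *: a i].

Definition cspan_pred (X : normedModType R[i]) (A : set X) : {pred X} :=
  fun x => `[< closure (linear_span A) x >].

Record cspan (X : normedModType R[i]) (A : set X) := CSpan {
  cspan_val :> X;
  cspanP : cspan_val \in cspan_pred A }.

Lemma linear_span_submod (X : normedModType R[i]) (A : set X) (b : R[i]) x y :
  linear_span A x -> linear_span A y -> linear_span A (b *: x + y).
Proof.
move=> [n [c [a [Aa ->]]]] [m [d [e [Ae ->]]]].
exists (n + m)%N.
exists (fun i => match fintype.split i with inl j => b * c j | inr j => d j end).
exists (fun i => match fintype.split i with inl j => a j | inr j => e j end).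
split=> [i|]; first by case: (fintype.split i).
rewrite big_split_ord/= scaler_sumr; congr (_ + _); apply: eq_bigr => i _.
  by rewrite (unsplitK (inl i)) scalerA.
by rewrite (unsplitK (inr i)).
Qed.

Lemma cspan_submod_closed (X : normedModType R[i]) (A : set X) :
  submod_closed (cspan_pred A).
Proof.
split=> [|b x y /asboolP/nrm_closure cx /asboolP/nrm_closure cy].
  apply/asboolP/subset_closure.
  by exists 0%N, (fun=> 0), (fun=> 0); split=> [[]//|]; rewrite big_ord0.
apply/asboolP/nrm_closure => d d0.
pose k : R := nrm (b : R[i]^o) + 1.
have k0 : 0 < k by rewrite ltr_wpDl ?nrm_ge0.
have dk : 0 < d / k by rewrite divr_gt0.
have [x' Ax' xx'] := cx _ dk; have [y' Ay' yy'] := cy _ dk.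
exists (b *: x' + y'); first exact: linear_span_submod.
rewrite opprD addrACA -scalerBr; apply: le_lt_trans (nrmD _ _) _.
have -> : d = nrm (b : R[i]^o) * (d / k) + d / k.
  by rewrite -[X in _ + X]mul1r -mulrDl -/k mulrC divfK// gt_eqF.
by rewrite nrmZ ler_ltD// ler_wpM2l ?nrm_ge0// ltW.
Qed.

Section cspan_structure.
Context {X : normedModType R[i]} {A : set X}.

HB.instance Definition _ :=
  GRing.isSubmodClosed.Build _ _ (cspan_pred A) (cspan_submod_closed A).
HB.instance Definition _ := [isSub for @cspan_val X A].
HB.instance Definition _ := [Choice of cspan A by <:].
HB.instance Definition _ := [SubChoice_isSubLmodule of cspan A by <:].

Implicit Types u v : cspan A.

Lemma cspan_normD u v : `|val (u + v)| <= `|val u| + `|val v|.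
Proof. by rewrite raddfD ler_normD. Qed.

Lemma cspan_normZ (a : R[i]) u : `|val (a *: u)| = `|a| * `|val u|.
Proof. by rewrite linearZ normrZ. Qed.

Lemma cspan_norm_eq0 u : `|val u| = 0 -> u = 0.
Proof. by move/normr0_eq0 => u0; exact: val_inj. Qed.

HB.instance Definition _ :=
  @Lmodule_isNormed.Build R[i] (cspan A) (fun u => `|val u|)
    cspan_normD cspan_normZ cspan_norm_eq0.

Lemma nrm_cspan u : nrm u = nrm (val u).
Proof. by []. Qed.

End cspan_structure.

Lemma cspan_complete (X : completeNormedModType R[i]) (A : set X)
    (H : set_system (cspan A)) :
  ProperFilter H -> cauchy H -> cvg H.
Proof.
move=> HH /nrm_cauchy Hc.
have : cauchy (@cspan_val X A @ H).
  apply/nrm_cauchy => d d0; have [u Hu] := Hc _ d0; exists (val u).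
  suff : H [set v : cspan A | nrm (val u - val v) < d] by [].
  by apply: filterS Hu => v /=; rewrite nrm_cspan raddfB.
move=> /cauchy_cvg/cvg_ex[l /nrm_cvg Hl].
have lP : l \in cspan_pred A.
  apply/asboolP; apply: closed_closure.
  apply/nrm_closure => d /Hl Hd.
  have [v /= lv] := filter_ex (Hd : H [set v | nrm (l - val v) < d]).
  by exists (val v) => //; have /asboolP := cspanP v.
apply/cvg_ex; exists (CSpan lP); apply/nrm_cvg => d /Hl Hd.
suff : H [set v : cspan A | nrm (l - val v) < d].
  by apply: filterS => v /=; rewrite nrm_cspan raddfB.
exact: Hd.
Qed.

HB.instance Definition _ (X : completeNormedModType R[i]) (A : set X) :=
  Uniform_isComplete.Build (cspan A) (@cspan_complete X A).

End closed_span.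

Notation banach R := (completeNormedModType R[i]).

(* The coercion to types makes U -> F the functions on the subtype of E given
   by wset, so two such functions are equal as soon as they agree on U. *)
Record wopen (R : realType) (E : banach R) := WOpen {
  wset :> set E;
  wset_open : open wset;
  weight : wset -> R;
  weight_gt0 : forall x, 0 < weight x;
  weight_continuous : continuous weight }.

Section weighted_holomorphic.
Context {R : realType} {E : banach R}.
Implicit Types (U : wopen E) (F : banach R).

(* The scalar field being R[i], differentiable is complex Frechet
   differentiability.  As U is open, the values of the extension 'valL_0 f of f
   by 0 outside U are irrelevant. *)
Definition holomorphic U F (f : U -> F) :=
  forall x : U, differentiable ('valL_(0 : F) f) (set_val x).

Definition wbounded U F (f : U -> F) :=
  has_ubound (range (fun x : U => weight x * nrm (f x))).

(* On the empty set wnorm is 0, since sup set0 = 0. *)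
Definition wnorm U F (f : U -> F) : R :=
  sup (range (fun x : U => weight x * nrm (f x))).

Definition Hv U F : set (U -> F) := [set f | holomorphic f /\ wbounded f].

Definition hv_pred U F : {pred U -> F} := fun f => `[< Hv f >].
Arguments hv_pred : clear implicits.

Record hv U F := HvFun {
  hv_fun :> U -> F;
  hvP : hv_fun \in hv_pred U F }.

Lemma hv_submod_closed U F : submod_closed (hv_pred U F).
Proof.
have valL0 : 'valL_(0 : F) (0 : U -> F) = cst 0.
  by apply/funext => x; rewrite /valL_ /=; case: ('oinv_set_val x).
have valLD (f g : U -> F) :
    'valL_(0 : F) (f + g) = 'valL_(0 : F) f + 'valL_(0 : F) g.
  by apply/funext => x; rewrite /valL_ !fctE /=; case: ('oinv_set_val x) => //=;
    rewrite addr0.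
have valLZ (a : R[i]) (f : U -> F) :
    'valL_(0 : F) (a *: f) = a *: 'valL_(0 : F) f.
  by apply/funext => x; rewrite /valL_ !fctE /=; case: ('oinv_set_val x) => //=;
    rewrite scaler0.
split=> [|a f g /asboolP[hf [M fM]] /asboolP[hg [N gN]]]; apply/asboolP; split.
- by move=> x; rewrite valL0; exact: differentiable_cst.
- by exists 0 => _ [x _ <-]; rewrite nrm0 mulr0.
- move=> x; rewrite valLD valLZ; apply: differentiableD; last exact: hg.
  by apply: differentiableZ; exact: hf.
- exists (nrm (a : R[i]^o) * M + N) => _ [x _ <-].
  apply: (@le_trans _ _ (weight x * (nrm (a *: f x) + nrm (g x)))).
    by rewrite ler_wpM2l ?(ltW (weight_gt0 x))//; exact: nrmD.
  rewrite mulrDr nrmZ mulrCA lerD//.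
    by rewrite ler_wpM2l ?nrm_ge0//; apply: fM; exists x.
  by apply: gN; exists x.
Qed.

Section hv_structure.
Context {U : wopen E} {F : banach R}.

HB.instance Definition _ :=
  GRing.isSubmodClosed.Build _ _ (hv_pred U F) (@hv_submod_closed U F).
HB.instance Definition _ := [isSub for @hv_fun U F].
HB.instance Definition _ := [Choice of hv U F by <:].
HB.instance Definition _ := [SubChoice_isSubLmodule of hv U F by <:].

Implicit Types f g : hv U F.

Lemma wnormP (f : U -> F) x : Hv f -> weight x * nrm (f x) <= wnorm f.
Proof.
move=> [_ bf]; apply: sup_upper_bound; last by exists x.
by split=> //; exists (weight x * nrm (f x)), x.
Qed.

Lemma hvE f : Hv f.
Proof. by have /asboolP := hvP f. Qed.

Lemma wnorm_ge0 (f : U -> F) : Hv f -> 0 <= wnorm f.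
Proof.
move=> Hf; have [[y [x _ _]]|/set0P/negP/negPn/eqP fr0] := pselect
  (range (fun x : U => weight x * nrm (f x)) !=set0).
  apply: le_trans (wnormP x Hf).
  by rewrite mulr_ge0 ?nrm_ge0// ltW ?weight_gt0.
by rewrite /wnorm fr0 sup0.
Qed.

Lemma wnorm_le (f : U -> F) (M : R) : 0 <= M ->
  (forall x, weight x * nrm (f x) <= M) -> wnorm f <= M.
Proof.
move=> M0 fM; have [fr|/set0P/negP/negPn/eqP fr0] := pselect
  (range (fun x : U => weight x * nrm (f x)) !=set0).
  by apply: ge_sup => // _ [x _ <-].
by rewrite /wnorm fr0 sup0.
Qed.

Lemma hv_normD f g : (wnorm (f + g : hv U F))%:C <= (wnorm f)%:C + (wnorm g)%:C.
Proof.
rewrite -rmorphD lecR wnorm_le ?addr_ge0 ?wnorm_ge0//; try exact: hvE.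
move=> x; apply: (@le_trans _ _ (weight x * (nrm (f x) + nrm (g x)))).
  by rewrite ler_wpM2l ?(ltW (weight_gt0 x))//; exact: nrmD.
by rewrite mulrDr lerD// wnormP//; exact: hvE.
Qed.

Lemma hv_normZ (a : R[i]) f : (wnorm (a *: f : hv U F))%:C = `|a| * (wnorm f)%:C.
Proof.
have le b g : wnorm (b *: g : hv U F) <= nrm (b : R[i]^o) * wnorm g.
  rewrite wnorm_le ?mulr_ge0 ?nrm_ge0 ?wnorm_ge0//; first exact: hvE.
  move=> x; rewrite [nrm _]nrmZ mulrCA ler_wpM2l ?nrm_ge0//.
  by apply: wnormP; exact: hvE.
have nE : (nrm (a : R[i]^o))%:C = `|a| by rewrite nrmE.
rewrite -nE -rmorphM/=; congr (_%:C); apply/eqP; rewrite eq_le le/=.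
have [->|a0] := eqVneq a 0.
  by rewrite nrm0 mul0r wnorm_ge0//; exact: (hvE (0 *: f : hv U F)).
have na0 : 0 < nrm (a : R[i]^o) by rewrite -ltcR nE normr_gt0.
rewrite mulrC -ler_pdivlMr//.
have := le a^-1 (a *: f); rewrite scalerA mulVf// scale1r => /le_trans; apply.
rewrite mulrC ler_wpM2l ?wnorm_ge0//; first exact: hvE.
by rewrite -lecR nrmE normfV -nE fmorphV.
Qed.

Lemma hv_norm_eq0 f : (wnorm f)%:C = 0 -> f = 0.
Proof.
move/complexI => f0; apply/val_inj/funext => x; apply: nrm0_eq0; apply/eqP.
rewrite eq_le nrm_ge0 andbT -(@ler_pM2l _ (weight x)) ?weight_gt0// mulr0 -f0.
by apply: wnormP; exact: hvE.
Qed.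

HB.instance Definition _ :=
  @Lmodule_isNormed.Build R[i] (hv U F) (fun f => (wnorm f)%:C)
    hv_normD hv_normZ hv_norm_eq0.

Lemma nrm_hv f : nrm f = wnorm f.
Proof. by []. Qed.

End hv_structure.

Section predual.
Context (U : wopen E).

Definition dual := bop (hv U (cplx R)) (cplx R).

Lemma dirac_subproof (x : U) :
  (fun f : hv U (cplx R) => f x) \in bop_pred (hv U (cplx R)) (cplx R).
Proof.
apply/asboolP; pose ev (f : hv U (cplx R)) : cplx R := f x.
have evlin : linear ev by [].
split=> //; suff : continuous ev by [].
pose evL : {linear hv U (cplx R) -> cplx R} :=
  HB.pack ev (GRing.isLinear.Build R[i] _ _ _ ev evlin).
suff : continuous evL by [].
apply: bounded_linear_continuous; apply/linear_boundedP.
exists ((weight x)^-1)%:C; split; first by apply/complex_realP; eexists.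
move=> M xM f; apply: (@le_trans _ _ (((weight x)^-1)%:C * `|f|)); last first.
  by rewrite ler_wpM2r// ltW.
rewrite -(nrmE (evL f)) -(nrmE f) -rmorphM/= lecR nrm_hv.
rewrite ler_pdivlMl ?weight_gt0//; exact: (wnormP x (hvE f)).
Qed.

Definition dirac (x : U) : dual := Bop (dirac_subproof x).

Definition predual := cspan (range dirac).

Lemma Delta_subproof (x : U) : dirac x \in cspan_pred (range dirac).
Proof.
apply/asboolP/subset_closure; exists 1%N, (fun=> 1), (fun=> dirac x); split.
  by move=> _; exists x.
by rewrite big_ord1 scale1r.
Qed.

Definition Delta (x : U) : predual := CSpan (Delta_subproof x).

(* The operator T_f.  Exactly one T satisfies the equation when Hv U F f, so
   the default value 0 plays no role then. *)
Definition linearization (F : banach R) (f : U -> F) : bop predual F :=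
  xget 0 [set T : bop predual F | T \o Delta = f].

End predual.

End weighted_holomorphic.

Arguments Hv {R E} U F.

(* The norms are extended real valued because the supremum defining the norm of
   A^-1 o I may be infinite when A is normed but not complete, for example when
   A is the ideal of finite rank operators with the operator norm.  The norms
   of normed ideals are required to be finite below. *)
Record op_class (R : realType) := OpClass {
  op_mem : forall E F : banach R, set (bop E F);
  op_norm : forall E F : banach R, bop E F -> \bar R }.

Record wh_class (R : realType) := WhClass {
  wh_mem : forall (E : banach R) (U : wopen E) (F : banach R), set (U -> F);
  wh_norm : forall (E : banach R) (U : wopen E) (F : banach R),
    (U -> F) -> \bar R }.

Arguments op_mem {R} I {E F} T : rename.
Arguments op_norm {R} I {E F} T : rename.
Arguments wh_mem {R} J {E U F} f : rename.
Arguments wh_norm {R} J {E U F} f : rename.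

(* Pietsch's axioms.  They imply homogeneity and (nrm T)%:E <= op_norm I T. *)
Record normed_operator_ideal (R : realType) (I : op_class R) : Prop := {
  oi_norm_fin : forall (E F : banach R) (T : bop E F),
    op_mem I T -> (0 <= op_norm I T < +oo)%E;
  oi_id : op_mem I (bop_id (cplx R)) /\ op_norm I (bop_id (cplx R)) = 1%E;
  oi_add : forall (E F : banach R) (S T : bop E F),
    op_mem I S -> op_mem I T ->
    op_mem I (S + T) /\ (op_norm I (S + T)%R <= op_norm I S + op_norm I T)%E;
  oi_comp : forall (E0 E F F0 : banach R)
      (Q : bop F F0) (S : bop E F) (T : bop E0 E),
    op_mem I S ->
    op_mem I (bop_comp Q (bop_comp S T)) /\
    (op_norm I (bop_comp Q (bop_comp S T)) <=
       (nrm Q)%:E * op_norm I S * (nrm T)%:E)%E }.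

Section wh_ideal.
Context {R : realType}.

Definition wopen_sub (E : banach R) (V U : wopen E) :=
  V `<=` U /\
  forall (x : V) (y : U), set_val x = set_val y -> weight x = weight y.

Definition weight_ratios (E : banach R) (V U : wopen E) (h : V -> U) : set R :=
  range (fun x : V => weight x / weight (h x)).

Record normed_wh_ideal (J : wh_class R) : Prop := {
  wh_sub : forall (E : banach R) (U : wopen E) (F : banach R),
    wh_mem J `<=` Hv U F;
  wh_mem0 : forall (E : banach R) (U : wopen E) (F : banach R),
    wh_mem J (0 : U -> F);
  wh_memD : forall (E : banach R) (U : wopen E) (F : banach R) (f g : U -> F),
    wh_mem J f -> wh_mem J g -> wh_mem J (f + g);
  wh_memZ : forall (E : banach R) (U : wopen E) (F : banach R)
      (a : R[i]) (f : U -> F),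
    wh_mem J f -> wh_mem J (a *: f);
  wh_norm_fin : forall (E : banach R) (U : wopen E) (F : banach R)
      (f : U -> F),
    wh_mem J f -> (0 <= wh_norm J f < +oo)%E;
  wh_norm_eq0 : forall (E : banach R) (U : wopen E) (F : banach R)
      (f : U -> F),
    wh_mem J f -> wh_norm J f = 0%E -> f = 0;
  wh_normD : forall (E : banach R) (U : wopen E) (F : banach R)
      (f g : U -> F),
    wh_mem J f -> wh_mem J g ->
    (wh_norm J (f + g)%R <= wh_norm J f + wh_norm J g)%E;
  wh_normZ : forall (E : banach R) (U : wopen E) (F : banach R)
      (a : R[i]) (f : U -> F),
    wh_mem J f -> wh_norm J (a *: f) = ((nrm (a : cplx R))%:E * wh_norm J f)%E;
  wh_norm_ge : forall (E : banach R) (U : wopen E) (F : banach R)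
      (f : U -> F),
    wh_mem J f -> ((wnorm f)%:E <= wh_norm J f)%E;
  wh_rank1 : forall (E : banach R) (U : wopen E) (F : banach R)
      (h : U -> cplx R) (y : F),
    Hv U (cplx R) h ->
    wh_mem J (fun x : U => (h x : R[i]) *: y) /\
    wh_norm J (fun x : U => (h x : R[i]) *: y) = (wnorm h * nrm y)%:E;
  wh_comp : forall (E : banach R) (V U : wopen E) (F G : banach R)
      (h : V -> U) (f : U -> F) (T : bop F G),
    wopen_sub V U ->
    holomorphic (fun x : V => set_val (h x) : E) ->
    has_ubound (weight_ratios h) ->
    wh_mem J f ->
    wh_mem J (T \o f \o h) /\
    (wh_norm J (T \o f \o h) <=
       (nrm T)%:E * wh_norm J f * (sup (weight_ratios h))%:E)%E }.

Definition linearization_property (J : wh_class R) (I : op_class R) :=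
  forall (E : banach R) (U : wopen E) (F : banach R) (f : U -> F),
    Hv U F f ->
    (wh_mem J f <-> op_mem I (linearization f)) /\
    (wh_mem J f -> wh_norm J f = op_norm I (linearization f)).

Definition op_quotient (A I : op_class R) : op_class R := {|
  op_mem := fun (E F : banach R) => [set T : bop E F |
    forall (G : banach R) (S : bop F G),
      op_mem A S -> op_mem I (bop_comp S T)];
  op_norm := fun (E F : banach R) (T : bop E F) =>
    ereal_sup [set r | exists (G : banach R) (S : bop F G),
      [/\ op_mem A S, (op_norm A S <= 1)%E &
          r = op_norm I (bop_comp S T)]] |}.

Definition wh_quotient (A : op_class R) (J : wh_class R) : wh_class R := {|
  wh_mem := fun (E : banach R) (U : wopen E) (F : banach R) =>
    [set f : U -> F | Hv U F f /\
      forall (G : banach R) (S : bop F G), op_mem A S -> wh_mem J (S \o f)];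
  wh_norm := fun (E : banach R) (U : wopen E) (F : banach R) (f : U -> F) =>
    ereal_sup [set r | exists (G : banach R) (S : bop F G),
      [/\ op_mem A S, (op_norm A S <= 1)%E & r = wh_norm J (S \o f)]] |}.

Definition wh_composition (B : op_class R) : wh_class R := {|
  wh_mem := fun (E : banach R) (U : wopen E) (F : banach R) =>
    [set f : U -> F | exists (G : banach R) (T : bop G F) (g : U -> G),
      [/\ op_mem B T, Hv U G g & f = T \o g]];
  wh_norm := fun (E : banach R) (U : wopen E) (F : banach R) (f : U -> F) =>
    ereal_inf [set r | exists (G : banach R) (T : bop G F) (g : U -> G),
      [/\ op_mem B T, Hv U G g, f = T \o g &
          r = (op_norm B T * (wnorm g)%:E)%E]] |}.

Definition wh_class_eq (J K : wh_class R) :=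
  forall (E : banach R) (U : wopen E) (F : banach R) (f : U -> F),
    (wh_mem J f <-> wh_mem K f) /\ (wh_mem J f -> wh_norm J f = wh_norm K f).

End wh_ideal.

(* Main.v *)
(* For [f] in the left-hand quotient let [T] be its linearization.  By (LP)
   the operators [S \o T] with [S] in [A] are the linearizations of the
   functions [S \o f], so [T] lies in [A^-1 o I] with the norm of [f], and
   [f = T \o Delta] is the required factorization since [Delta] has norm at
   most 1.  Conversely, if [f = T \o g] then the linearization of [S \o f] is
   [S \o T] composed with the linearization of [g].

   This rests on two facts about the predual.  [Delta] is holomorphic: Cauchy
   estimates, obtained from Goursat's theorem on rectangles, bound the
   second-order Taylor remainder of [f] at [x] uniformly over the unit ball of
   scalar functions [f].  Linearizations exist: the functionals [u] for which
   some [y] in [F] satisfies [phi y = u (phi \o f)] for every [phi] in the dual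
   of [F] form a closed subspace, by the Hahn-Banach theorem. *)
From HB Require Import structures.
From mathcomp Require Import all_boot all_order all_algebra.
From mathcomp Require Import all_classical all_reals all_analysis.
From mathcomp Require Import complex ring lra.
Require Import Defs.

Set Implicit Arguments.
Unset Strict Implicit.
Unset Printing Implicit Defensive.

Import Order.TTheory GRing.Theory Num.Theory.
Import numFieldNormedType.Exports.

Local Open Scope classical_set_scope.
Local Open Scope ring_scope.
Local Open Scope complex_scope.

(** * Goursat's theorem on rectangles *)

(** Holomorphy means complex Frechet differentiability at every point, with no continuity of the
    derivative, which is why the chain starts from Goursat's bisection. Integrals are those of real
    functions, hence the real form [Im (f dz)]. Only the size of derivatives matters, so a crude
    two-sided estimate of one circulation replaces Cauchy's integral formula; the constants 12, 24
    and 1152 are not meant to be sharp. Differentiability of each scalar function separately says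
    little about [Delta], whose remainder is measured in the dual norm: the remainder must be
    bounded by a constant that depends on the function only through its norm. The derivative found
    in this way is a functional in the dual, and must still be shown to lie in the closed span of
    the evaluations. For linearizations, [phi |-> u (phi \o f)] is an element of the bidual of [F].
    The point is that it comes from a vector of [F]: this holds for evaluations and survives limits
    because [F] is complete. *)

Section real_rectangles.
Context {R : realType}.
Implicit Types (a b c d x y e : R) (f g : R -> R).

Lemma rectangle_induction (G : R -> R -> R -> R -> Prop) a b c d :
  a <= b -> c <= d ->
  (forall a' b' c' d', a <= a' -> a' <= b' -> b' <= b ->
    c <= c' -> c' <= d' -> d' <= d ->
    G a' ((a' + b') / 2) c' ((c' + d') / 2) ->
    G ((a' + b') / 2) b' c' ((c' + d') / 2) ->
    G a' ((a' + b') / 2) ((c' + d') / 2) d' ->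
    G ((a' + b') / 2) b' ((c' + d') / 2) d' -> G a' b' c' d') ->
  (forall x y, a <= x <= b -> c <= y <= d -> exists2 e, 0 < e &
    forall a' b' c' d', a <= a' -> a' <= x -> x <= b' -> b' <= b ->
    c <= c' -> c' <= y -> y <= d' -> d' <= d ->
    b' - a' < e -> d' - c' < e -> G a' b' c' d') ->
  G a b c d.
Proof.
move=> ab cd split local; apply: contrapT => nG.
pose T := ((R * R) * (R * R))%type.
pose inv (Q : T) := [/\ a <= Q.1.1, Q.1.1 <= Q.1.2 & Q.1.2 <= b] /\
  [/\ c <= Q.2.1, Q.2.1 <= Q.2.2 & Q.2.2 <= d] /\
  ~ G Q.1.1 Q.1.2 Q.2.1 Q.2.2.
pose half (Q Q' : T) := [/\ inv Q', Q.1.1 <= Q'.1.1, Q'.1.2 <= Q.1.2 &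
   Q'.1.2 - Q'.1.1 = (Q.1.2 - Q.1.1) / 2] /\ [/\ Q.2.1 <= Q'.2.1, Q'.2.2 <= Q.2.2 &
   Q'.2.2 - Q'.2.1 = (Q.2.2 - Q.2.1) / 2].
have /choice[step stepP] : forall Q, exists Q', inv Q -> half Q Q'.
  move=> [[a' b'] [c' d']]; have [|ni] := pselect (inv ((a', b'), (c', d'))); last first.
    by exists ((a', b'), (c', d')).
  move=> [] /= [aa ab' bb] [[cc cd' dd] nG'].
  have [Q' hQ] : exists Q', half ((a', b'), (c', d')) Q'.
    apply: contrapT => /forallNP nQ; apply: nG'; apply: split => //;
      apply: contrapT => nG'.
    - apply: (nQ ((a', (a' + b') / 2), (c', (c' + d') / 2))); do !split => //=; lra.
    - apply: (nQ (((a' + b') / 2, b'), (c', (c' + d') / 2))); do !split => //=; lra.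
    - apply: (nQ ((a', (a' + b') / 2), ((c' + d') / 2, d'))); do !split => //=; lra.
    - apply: (nQ (((a' + b') / 2, b'), ((c' + d') / 2, d'))); do !split => //=; lra.
  by exists Q'.
pose Q n := iter n step ((a, b), (c, d)).
have Qinv n : inv (Q n).
  by elim: n => [|n /stepP[[]]//]; rewrite /Q /=; do !split => //=; exact: lexx.
have Qstep n : half (Q n) (Q n.+1) := stepP _ (Qinv n).
have nested (u v : T -> R) (w : R) :
    (forall n, u (Q n) <= u (Q n.+1)) -> (forall n, v (Q n.+1) <= v (Q n)) ->
    (forall n, u (Q n) <= v (Q n)) ->
    exists x : R, forall n, u (Q n) <= x <= v (Q n).
  move=> un vn uv.
  have uh n m : u (Q n) <= u (Q (n + m)%N).
    by elim: m => [|m IH]; rewrite ?addn0// addnS; apply: le_trans IH (un _).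
  have vh n m : v (Q (n + m)%N) <= v (Q n).
    by elim: m => [|m IH]; rewrite ?addn0// addnS; apply: le_trans (vn _) IH.
  have ub n : ubound (range (fun m => u (Q m))) (v (Q n)).
    move=> _ [m _ <-]; apply: le_trans (uh m n) _; apply: le_trans (uv _) _.
    by rewrite addnC.
  have u0 : range (fun m => u (Q m)) !=set0 by exists (u (Q 0%N)), 0%N.
  exists (sup (range (fun m => u (Q m)))) => n; apply/andP; split.
    by apply: sup_upper_bound; [split=> //; exists (v (Q 0%N))|exists n].
  exact: ge_sup.
have [x xP] : exists x : R, forall n, (Q n).1.1 <= x <= (Q n).1.2.
  apply: (nested (fun Q => Q.1.1) (fun Q => Q.1.2) 0) => n.
  - by have [[]] := Qstep n.
  - by have [[]] := Qstep n.
  - by have [[]] := Qinv n.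
have [y yP] : exists y : R, forall n, (Q n).2.1 <= y <= (Q n).2.2.
  apply: (nested (fun Q => Q.2.1) (fun Q => Q.2.2) 0) => n.
  - by have [_ []] := Qstep n.
  - by have [_ []] := Qstep n.
  - by have [_ [[]]] := Qinv n.
have [e e0 eP] := local _ _ (xP 0%N) (yP 0%N).
have w1 n : (Q n).1.2 - (Q n).1.1 = (b - a) / 2 ^+ n.
  elim: n => [|n IH]; first by rewrite expr0 divr1.
  by have [[_ _ _ ->] _] := Qstep n; rewrite IH exprS; field; apply: expf_neq0.
have w2 n : (Q n).2.2 - (Q n).2.1 = (d - c) / 2 ^+ n.
  elim: n => [|n IH]; first by rewrite expr0 divr1.
  by have [_ [_ _ ->]] := Qstep n; rewrite IH exprS; field; apply: expf_neq0.
have [n nP] : exists n, (b - a + (d - c)) / 2 ^+ n < e.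
  have s0 : 0 <= b - a + (d - c) by lra.
  exists (Num.bound ((b - a + (d - c)) / e)).
  rewrite ltr_pdivrMr ?exprn_gt0// mulrC -ltr_pdivrMr//.
  have := archi_boundP (divr_ge0 s0 (ltW e0)) => /lt_trans; apply.
  by rewrite -natrX ltr_nat ltn_expl.
have p0 : 0 < (2 ^+ n)^-1 :> R by rewrite invr_gt0 exprn_gt0.
have [[i1 i2 i3] [[i4 i5 i6] +]] := Qinv n; apply.
have /andP[x1 x2] := xP n; have /andP[y1 y2] := yP n.
apply: eP => //; rewrite ?w1 ?w2; apply: le_lt_trans nP; rewrite ler_pM2r//; lra.
Qed.

Local Notation mu := (@lebesgue_measure R).

Lemma continuous_in_integrable f a b : {in `[a, b], continuous f} ->
  mu.-integrable `[a, b] (EFin \o f).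
Proof.
move=> cf; apply: continuous_compact_integrable; first exact: segment_compact.
by apply: continuous_in_subspaceT => x; rewrite inE /= => xab; apply: cf.
Qed.

End real_rectangles.

Section goursat.
Context {R : realType}.
Implicit Types (a b c d x y e r : R) (f g : R -> R).
Local Notation mu := (@lebesgue_measure R).

Lemma Rintegral_bounds f a b (m n : R) : a <= b ->
  {in `[a, b], continuous f} -> (forall x, a <= x <= b -> m <= f x <= n) ->
  m * (b - a) <= \int[mu]_(x in `[a, b]) f x <= n * (b - a).
Proof.
move=> ab /continuous_in_integrable fi fmn.
have muE : fine (mu `[a, b]) = b - a.
  rewrite lebesgue_measure_itv/= lte_fin.
  have [//|ba] := ltP a b; suff -> : b = a by rewrite subrr.
  by apply/le_anti/andP.
have cstE (r : R) : r * (b - a) = \int[mu]_(x in `[a, b]) r.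
  by rewrite Rintegral_cst//; congr (_ * _); exact/esym.
have ci r : mu.-integrable `[a, b] (EFin \o cst r).
  by apply: continuous_in_integrable => x _; exact: cst_continuous.
rewrite !cstE; apply/andP; split; apply: le_Rintegral => //; try exact: ci;
  by move=> x /=; rewrite in_itv/= => /fmn/andP[].
Qed.

Lemma Rintegral_near_cst f a b (k e : R) : a <= b ->
  {in `[a, b], continuous f} ->
  (forall x, a <= x <= b -> `|f x - k| <= e) ->
  `|\int[mu]_(x in `[a, b]) f x - k * (b - a)| <= e * (b - a).
Proof.
move=> ab cf fe; rewrite ler_norml -mulNr lerBrDr lerBlDr -!mulrDl.
apply: Rintegral_bounds => // x /fe; rewrite ler_norml; lra.
Qed.

Lemma Rintegral_chasles f a m b : a <= m -> m <= b ->
  {in `[a, b], continuous f} ->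
  \int[mu]_(x in `[a, b]) f x =
  \int[mu]_(x in `[a, m]) f x + \int[mu]_(x in `[m, b]) f x.
Proof.
move=> am mb cf; have fi := continuous_in_integrable cf.
rewrite -(@Rintegral_itv_obnd_cbnd _ m (BRight b)); last first.
  by apply: integrableS fi => //; apply: subset_itvr; rewrite bnd_simp.
by rewrite -(Rintegral_itvB fi (_ : _ <= BRight m)%O)// addrC subrK.
Qed.

(** The line integral of [P dx + Q dy] counterclockwise around the boundary of [[a, b] x [c, d]]. *)
Definition circulation (P Q : R -> R -> R) a b c d : R :=
  (\int[mu]_(x in `[a, b]) P x c - \int[mu]_(x in `[a, b]) P x d) +
  (\int[mu]_(y in `[c, d]) Q b y - \int[mu]_(y in `[c, d]) Q a y).

(* The form [P dx + Q dy] is differentiable at the point and the shared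
   coefficient [k] says that [P_y = Q_x] there. *)
Definition closed_at (P Q : R -> R -> R) x0 y0 := exists p q k,
  forall e, 0 < e -> exists2 r, 0 < r & forall x y,
  `|x - x0| < r -> `|y - y0| < r ->
  `|P x y - P x0 y0 - (p * (x - x0) + k * (y - y0))| <=
     e * (`|x - x0| + `|y - y0|) /\
  `|Q x y - Q x0 y0 - (k * (x - x0) + q * (y - y0))| <=
     e * (`|x - x0| + `|y - y0|).

Lemma affine_approx_continuous f x0 (p : R) :
  (forall e, 0 < e -> exists2 r, 0 < r & forall x, `|x - x0| < r ->
    `|f x - f x0 - p * (x - x0)| <= e * `|x - x0|) ->
  {for x0, continuous f}.
Proof.
move=> fp; apply/cvgrPdist_lt => e e0.
have [r r0 rP] := fp _ ltr01.
have p1 : 0 < `|p| + 1 by rewrite ltr_wpDl.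
exists (Num.min r (e / (`|p| + 1))); first by rewrite /= lt_min r0 divr_gt0.
move=> x /=; rewrite distrC lt_min => /andP[xr].
rewrite ltr_pdivlMr// => xe; apply: le_lt_trans xe. rewrite (distrC (f x0)).
have -> : f x - f x0 = (f x - f x0 - p * (x - x0)) + p * (x - x0) by rewrite subrK.
rewrite (le_trans (ler_normD _ _))//.
have -> : `|x - x0| * (`|p| + 1) = 1 * `|x - x0| + `|p| * `|x - x0| by ring.
by rewrite lerD// ?rP// normrM.
Qed.

Lemma closed_at_continuous P Q x y : closed_at P Q x y ->
  {for x, continuous (P ^~ y)} /\ {for y, continuous (Q x)}.
Proof.
move=> [p [q [k H]]]; split.
  apply: (@affine_approx_continuous _ _ p) => e /H[r r0 rP].
  exists r => // z zx; have := (rP z y zx); rewrite !subrr normr0 mulr0 !addr0.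
  by move=> /(_ r0)[].
apply: (@affine_approx_continuous _ _ q) => e /H[r r0 rP].
exists r => // z zx; have := (rP x z); rewrite !subrr normr0 mulr0 !add0r.
by move=> /(_ r0 zx)[_]; rewrite mulr0 add0r.
Qed.

Lemma circulation_splitx P Q a m b c d : a <= m -> m <= b ->
  {in `[a, b], continuous (P ^~ c)} -> {in `[a, b], continuous (P ^~ d)} ->
  circulation P Q a b c d = circulation P Q a m c d + circulation P Q m b c d.
Proof.
by move=> am mb Pc Pd; rewrite /circulation !(@Rintegral_chasles _ a m b)//; lra.
Qed.

Lemma circulation_splity P Q a b c m d : c <= m -> m <= d ->
  {in `[c, d], continuous (Q a)} -> {in `[c, d], continuous (Q b)} ->
  circulation P Q a b c d = circulation P Q a b c m + circulation P Q a b m d.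
Proof.
by move=> cm md Qa Qb; rewrite /circulation !(@Rintegral_chasles _ c m d)//; lra.
Qed.

Section rectangle.
Variables (P Q : R -> R -> R) (a b c d : R).
Hypothesis PQ : forall x y, a <= x <= b -> c <= y <= d -> closed_at P Q x y.

Let cP x y : a <= x <= b -> c <= y <= d -> {for x, continuous (P ^~ y)}.
Proof. by move=> xab ycd; have [] := closed_at_continuous (PQ xab ycd). Qed.

Let cQ x y : a <= x <= b -> c <= y <= d -> {for y, continuous (Q x)}.
Proof. by move=> xab ycd; have [] := closed_at_continuous (PQ xab ycd). Qed.

Let cPi a' b' y : a <= a' -> b' <= b -> c <= y <= d ->
  {in `[a', b'], continuous (P ^~ y)}.
Proof.
move=> aa bb cyd x; rewrite in_itv/= => /andP[x1 x2].
by apply: cP => //; rewrite (le_trans aa) ?(le_trans x2).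
Qed.

Let cQi c' d' x : c <= c' -> d' <= d -> a <= x <= b ->
  {in `[c', d'], continuous (Q x)}.
Proof.
move=> aa bb cyd y; rewrite in_itv/= => /andP[x1 x2].
by apply: cQ => //; rewrite (le_trans aa) ?(le_trans x2).
Qed.

(** In the affine part of the form, the terms in [p] and [q] cancel between opposite sides, while
    those in [k] give minus the area times [k] on the horizontal pair and plus the same on the
    vertical pair. What is left is the remainder, at most [e / 2 * S] at each boundary point, hence
    [e * S] on the difference of two opposite sides. *)
Lemma circulation_local x0 y0 e : a <= x0 <= b -> c <= y0 <= d -> 0 < e ->
  exists2 r, 0 < r & forall a' b' c' d',
    a <= a' -> a' <= x0 -> x0 <= b' -> b' <= b ->
    c <= c' -> c' <= y0 -> y0 <= d' -> d' <= d ->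
    b' - a' < r -> d' - c' < r ->
    `|circulation P Q a' b' c' d'| <= e * (b' - a' + (d' - c')) ^+ 2.
Proof.
move=> abx cdy e0; have [p [q [k]]] := PQ abx cdy.
have e20 : 0 < e / 2 by rewrite divr_gt0.
move=> /(_ _ e20)[r r0 rP]; exists r => //.
move=> a' b' c' d' h1 h2 h3 h4 h5 h6 h7 h8 w1 w2.
pose S := b' - a' + (d' - c').
have near x y : a' <= x <= b' -> c' <= y <= d' ->
    [/\ `|x - x0| < r, `|y - y0| < r &
     e / 2 * (`|x - x0| + `|y - y0|) <= e / 2 * S].
  move=> xab ycd.
  have xS : `|x - x0| <= b' - a' by rewrite ler_norml; lra.
  have yS : `|y - y0| <= d' - c' by rewrite ler_norml; lra.
  split; [exact: le_lt_trans w1|exact: le_lt_trans w2|].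
  by rewrite ler_wpM2l ?(ltW e20)// /S lerD.
rewrite /circulation -!RintegralB//; last first.
- by apply: continuous_in_integrable; apply: cPi => //; lra.
- by apply: continuous_in_integrable; apply: cPi => //; lra.
- by apply: continuous_in_integrable; apply: cQi => //; lra.
- by apply: continuous_in_integrable; apply: cQi => //; lra.
have I1 : `|\int[mu]_(x in `[a', b']) (P x c' - P x d') - k * (c' - d') * (b' - a')|
    <= e * S * (b' - a').
  apply: Rintegral_near_cst; first lra.
    move=> x xab; apply: continuousB.
      by move: x xab; apply: cPi => //; lra.
    by move: x xab; apply: cPi => //; lra.
  move=> x xab; have cc : c' <= c' <= d' by lra.
  have cd : c' <= d' <= d' by lra.
  have [n1 n2 n3] := near _ _ xab cc; have [n4 n5 n6] := near _ _ xab cd.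
  have [+ _] := rP _ _ n1 n2; have [+ _] := rP _ _ n4 n5.
  rewrite !ler_norml; move: n3 n6.
  have -> : e * S = e / 2 * S + e / 2 * S by field.
  set Z := e / 2 * S; set X := e / 2 * (_ + _); set Y := e / 2 * (_ + _).
  rewrite !mulrBr; lra.
have I2 : `|\int[mu]_(y in `[c', d']) (Q b' y - Q a' y) - k * (b' - a') * (d' - c')|
    <= e * S * (d' - c').
  apply: Rintegral_near_cst; first lra.
    move=> y ycd; apply: continuousB.
      by move: y ycd; apply: cQi => //; lra.
    by move: y ycd; apply: cQi => //; lra.
  move=> y ycd; have cc : a' <= a' <= b' by lra.
  have cd : a' <= b' <= b' by lra.
  have [n1 n2 n3] := near _ _ cc ycd; have [n4 n5 n6] := near _ _ cd ycd.
  have [_ +] := rP _ _ n1 n2; have [_ +] := rP _ _ n4 n5.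
  rewrite !ler_norml; move: n3 n6.
  have -> : e * S = e / 2 * S + e / 2 * S by field.
  set Z := e / 2 * S; set X := e / 2 * (_ + _); set Y := e / 2 * (_ + _).
  rewrite !mulrBr; lra.
have -> : e * S ^+ 2 = e * S * (b' - a') + e * S * (d' - c').
  by rewrite -mulrDr expr2 mulrA.
move: I1 I2; set u := \int[mu]_(x in _) _; set v := \int[mu]_(y in _) _.
set A := e * S * _; set B := e * S * _.
have -> : k * (c' - d') * (b' - a') = - (k * (b' - a') * (d' - c')) by ring.
set C := k * _ * _; rewrite !ler_norml; lra.
Qed.

(** The bound [e * S ^+ 2], with [S] half the perimeter, is stable under quartering: each quarter
    has half-perimeter [S / 2], and [4 * (S / 2) ^+ 2 = S ^+ 2]. So the local bound spreads to the
    whole rectangle by [rectangle_induction]. *)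
Lemma goursat : a <= b -> c <= d -> circulation P Q a b c d = 0.
Proof.
move=> ab cd; pose S := b - a + (d - c).
suff H e : 0 < e -> `|circulation P Q a b c d| <= e * S ^+ 2.
  apply/eqP; rewrite -normr_eq0 eq_le normr_ge0 andbT; apply/ler_addgt0Pl => e e0.
  have S1 : 0 < S ^+ 2 + 1 by rewrite ltr_wpDl ?sqr_ge0.
  rewrite addr0 (le_trans (H (e / (S ^+ 2 + 1)) _)) ?divr_gt0//.
  by rewrite mulrAC ler_pdivrMr// ler_wpM2l ?(ltW e0)// lerDl.
move=> e0; apply: (@rectangle_induction _ (fun a b c d =>
    `|circulation P Q a b c d| <= e * (b - a + (d - c)) ^+ 2)) => //.
  move=> a' b' c' d' h1 h2 h3 h4 h5 h6.
  set m := (a' + b') / 2; set n := (c' + d') / 2 => G1 G2 G3 G4.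
  have am : a' <= m by rewrite /m; lra.
  have mb : m <= b' by rewrite /m; lra.
  have cn : c' <= n by rewrite /n; lra.
  have nd : n <= d' by rewrite /n; lra.
  rewrite (circulation_splitx Q am mb); [|apply: cPi => //; lra..].
  rewrite !(circulation_splity P cn nd); try (apply: cQi => //; lra).
  have -> : e * (b' - a' + (d' - c')) ^+ 2 =
    (e * (m - a' + (n - c')) ^+ 2 + e * (m - a' + (d' - n)) ^+ 2) +
    (e * (b' - m + (n - c')) ^+ 2 + e * (b' - m + (d' - n)) ^+ 2).
    by rewrite /m /n; field.
  by rewrite (le_trans (ler_normD _ _))// lerD// (le_trans (ler_normD _ _))// lerD.
by move=> x y abx cdy; exact: circulation_local.
Qed.

End rectangle.

(** The large square is cut into a bottom and a top strip of full width, a left and a right piece,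
    and the small square. The first four avoid the interior of the small square, so Goursat's
    theorem applies to them even if the form is singular at the origin. *)
Lemma circulation_square P Q s r : 0 < s -> s <= r ->
  (forall x y, `|x| <= r -> `|y| <= r -> (s <= `|x|) || (s <= `|y|) ->
    closed_at P Q x y) ->
  circulation P Q (- r) r (- r) r = circulation P Q (- s) s (- s) s.
Proof.
move=> s0 sr PQ.
have {}PQ x y : - r <= x <= r -> - r <= y <= r ->
    [|| x <= - s, s <= x, y <= - s | s <= y] -> closed_at P Q x y.
  move=> xr yr xy; apply: PQ; rewrite ?ler_norml//.
  by rewrite (lerNr x) (lerNr y) in xy; rewrite !ler_normr; case/or4P: xy => ->; rewrite ?orbT.
have cP x y : - r <= x <= r -> - r <= y <= r -> (y <= - s) || (s <= y) ->
    {for x, continuous (P ^~ y)}.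
  move=> xr yr /orP yrs; have xy : closed_at P Q x y.
    by apply: PQ => //; case: yrs => ->; rewrite ?orbT.
  by have [] := closed_at_continuous xy.
have cQ x y : - r <= x <= r -> - r <= y <= r -> (x <= - s) || (s <= x) ->
    {for y, continuous (Q x)}.
  move=> xr yr /orP yrs; have xy : closed_at P Q x y.
    by apply: PQ => //; case: yrs => ->; rewrite ?orbT.
  by have [] := closed_at_continuous xy.
have cQr c d x : - r <= c -> d <= r -> (x = r) \/ (x = - r) ->
    {in `[c, d], continuous (Q x)}.
  move=> rc dr xr y; rewrite in_itv/= => yr; apply: cQ.
  - by case: xr => xr; rewrite xr; lra.
  - by lra.
  - by case: xr => xr; rewrite xr; apply/orP; [right|left]; lra.
have cPs c d y : - r <= c -> d <= r -> (y = s) \/ (y = - s) ->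
    {in `[c, d], continuous (P ^~ y)}.
  move=> rc dr ys x; rewrite in_itv/= => xr; apply: cP.
  - by lra.
  - by case: ys => ys; rewrite ys; lra.
  - by case: ys => ys; rewrite ys; apply/orP; [right|left]; lra.
rewrite (@circulation_splity _ _ _ _ (- r) (- s) r); try lra; last 2 first.
- by apply: cQr; try lra; right.
- by apply: cQr; try lra; left.
rewrite (@circulation_splity _ _ _ _ (- s) s r); try lra; last 2 first.
- by apply: cQr; try lra; right.
- by apply: cQr; try lra; left.
rewrite (@circulation_splitx _ _ (- r) (- s) r (- s) s); try lra; last 2 first.
- by apply: cPs; try lra; right.
- by apply: cPs; try lra; left.
rewrite (@circulation_splitx _ _ (- s) s r (- s) s); try lra; last 2 first.
- by apply: cPs; try lra; right.
- by apply: cPs; try lra; left.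
rewrite (@goursat P Q (- r) r (- r) (- s)) ?(@goursat P Q (- r) r s r)
  ?(@goursat P Q (- r) (- s) (- s) s) ?(@goursat P Q s r (- s) s);
  rewrite ?add0r ?addr0//; try lra;
  move=> x y xr yr; apply: PQ; try lra; apply/or4P;
  first [constructor 1; lra|constructor 2; lra|constructor 3; lra|constructor 4; lra].
Qed.

End goursat.

(** * Cauchy estimates *)

Section frechet.
Context {R : realType} {V W : normedModType R[i]}.
Implicit Types (f : V -> W) (x y : V).

Lemma differentiable_nrm f x : differentiable f x -> forall e : R, 0 < e ->
  exists2 r : R, 0 < r & forall y, nrm (y - x) < r ->
    nrm (f y - f x - 'd f x (y - x)) <= e * nrm (y - x).
Proof.
move=> /diff_locally/eqaddoP fx e e0.
have e0' : 0 < e%:C by rewrite ltcR.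
have := fx _ e0' => /nbhs_normP[d /= /complex_e2[r r0 <-]] rP.
exists r => // y yx; have := rP (y - x).
rewrite /= !fctE /= sub0r normrN -nrm_lt opprD addrA subrK => /(_ yx).
by rewrite nrm_le rmorphM/= nrmE.
Qed.

Lemma nrm_differentiable f x (D : {linear V -> W}) : continuous D ->
  (forall e : R, 0 < e -> exists2 r : R, 0 < r & forall y, nrm (y - x) < r ->
    nrm (f y - f x - D (y - x)) <= e * nrm (y - x)) ->
  differentiable f x /\ 'd f x = D :> (V -> W).
Proof.
move=> Dc fx.
have fD : f \o shift x = cst (f x) + D +o_ 0 id.
  apply/eqaddoP => _ /complex_e2[e e0 <-].
  have [r r0 rP] := fx _ e0; apply/nbhs_normP; exists r%:C; first by rewrite /= ltcR.
  move=> h; rewrite /= sub0r normrN -nrm_lt => hr.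
  have := rP (h + x); rewrite addrK => /(_ hr).
  by rewrite nrm_le rmorphM/= nrmE !fctE /= opprD addrA.
have dE := diff_unique Dc fD; split=> //.
by apply/diff_locallyP; rewrite dE.
Qed.

End frechet.

Section cauchy_estimate.
Context {R : realType}.
Local Notation C := (R[i]^o).
Implicit Types (z w : C).

Lemma nrm_Re z : `|complex.Re z| <= nrm z.
Proof. by rewrite -lecR nrmE; exact: normc_ge_Re. Qed.

Lemma nrm_Im z : `|complex.Im z| <= nrm z.
Proof.
rewrite -lecR nrmE normc_def lecR -sqrtr_sqr ler_sqrt ?lerDr ?sqr_ge0//.
by rewrite addr_ge0 ?sqr_ge0.
Qed.

Lemma nrm_real (r : R) : nrm (r%:C : C) = `|r|.
Proof. by rewrite /nrm normc_def /= expr0n addr0 sqrtr_sqr. Qed.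

Lemma nrmM z w : nrm (z * w : C) = nrm z * nrm w.
Proof. exact: (@nrmZ R C z w). Qed.

Lemma nrmV z : nrm (z^-1 : C) = (nrm z)^-1.
Proof.
have [->|z0] := eqVneq z 0; first by rewrite invr0 nrm0 invr0.
have nz0 : nrm z != 0 by apply: contraNneq z0 => /nrm0_eq0 ->.
by apply: (mulIf nz0); rewrite -nrmM !mulVf// /nrm normr1.
Qed.

Lemma nrm_le_ReIm z : nrm z <= `|complex.Re z| + `|complex.Im z|.
Proof.
rewrite {1}[z](complexE z); apply: le_trans (nrmD _ _) _; rewrite nrmM !nrm_real.
rewrite lerD// -[leRHS]mul1r ler_wpM2r//.
by rewrite /nrm normc_def /= expr0n expr1n add0r sqrtr1.
Qed.

Lemma diff_scalarE (f : C -> C) z h : differentiable f z ->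
  'd f z h = h * 'd f z 1.
Proof.
move=> _; have {1}-> : h = h *: (1 : C) by rewrite /GRing.scale /= mulr1.
by rewrite linearZ.
Qed.

(* The Cauchy-Riemann equations, in the form that [Im (f dz)] is closed. *)
Lemma differentiable_closed_at (f : C -> C) x y :
  differentiable f (x +i* y : C) ->
  closed_at (fun x y => complex.Im (f (x +i* y)))
    (fun x y => complex.Re (f (x +i* y))) x y.
Proof.
move=> fz; pose l := 'd f (x +i* y : C) 1.
(* For [h = dx + i dy], [Im (l * h) = Im l * dx + Re l * dy] and
   [Re (l * h) = Re l * dx - Im l * dy]; the shared coefficient is [Re l]. *)
exists (complex.Im l), (- complex.Im l), (complex.Re l) => e e0.
have [r r0 rP] := differentiable_nrm fz e0.
have r20 : 0 < r / 2 by rewrite divr_gt0.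
exists (r / 2) => // x' y' xr yr; pose h : C := (x' - x) +i* (y' - y).
have hE : (x' +i* y' : C) - (x +i* y : C) = h by [].
have hn : nrm h <= `|x' - x| + `|y' - y| := nrm_le_ReIm h.
have hr : nrm h < r by apply: le_lt_trans hn _; rewrite [r]splitr ltrD.
have := rP (x' +i* y'); rewrite hE => /(_ hr).
rewrite diff_scalarE// -/l => le1.
have le2 := le_trans le1 (ler_wpM2l (ltW e0) hn).
split; apply: le_trans le2.
  apply: le_trans (nrm_Im _); rewrite le_eqVlt; apply/orP; left; apply/eqP.
  congr (`|_|); case: (f _) => a b; case: (f _) => a' b' /=.
  by rewrite /h; case: (l) => u v /=; ring.
apply: le_trans (nrm_Re _); rewrite le_eqVlt; apply/orP; left; apply/eqP.
congr (`|_|); case: (f _) => a b; case: (f _) => a' b' /=.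
by rewrite /h; case: (l) => u v /=; ring.
Qed.

(* The circulation of [Im (f z / z^2 dz)] is the same around the squares of
   half-side [r] and [t]; it is at most [8 * M / r] by the bound on [f], and
   for small [t] it is close to that of [Im (l / z dz)], which is at least
   [4 * l]. *)
Lemma cauchy_estimate_pos (f : C -> C) (r s M l : R) : 0 < r -> 2 * r < s ->
  (forall z, nrm z < s -> differentiable f z) ->
  (forall z, nrm z < s -> nrm (f z) <= M) ->
  f 0 = 0 -> 'd f 0 1 = l%:C -> 0 <= l -> l <= 2 * M / r.
Proof.
move=> r0 rs fd fM f0 fl l0.
pose g : C -> C := f * (fun z => (z * z)^-1).
pose P x y := complex.Im (g (x +i* y)); pose Q x y := complex.Re (g (x +i* y)).
have sq x y : `|x| <= r -> `|y| <= r -> nrm (x +i* y : C) < s.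
  move=> xr yr; apply: le_lt_trans (nrm_le_ReIm _) _ => /=; lra.
have PQ x y : `|x| <= r -> `|y| <= r -> (x +i* y : C) != 0 -> closed_at P Q x y.
  move=> xr yr xy0; apply: differentiable_closed_at; apply: differentiableM.
    exact/fd/sq.
  apply: (@differentiableV _ _ (fun z : C => z * z)); last by rewrite mulf_neq0.
  exact: (@differentiableM _ _ id id).
have nz (x y t : R) : 0 < t -> (t <= `|x|) || (t <= `|y|) -> t <= nrm (x +i* y : C).
  by move=> t0 /orP[] /le_trans; apply; [exact: (nrm_Re (x +i* y))|exact: (nrm_Im (x +i* y))].
have nz0 z (t : R) : 0 < t -> t <= nrm z -> z != 0.
  by move=> t0 tz; apply: contraTneq tz => ->; rewrite nrm0 -ltNge.
have PQs (t x y : R) : 0 < t -> `|x| <= r -> `|y| <= r ->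
    (t <= `|x|) || (t <= `|y|) -> closed_at P Q x y.
  by move=> t0 xr yr xy; apply: PQ => //; apply: (nz0 _ t) => //; exact: nz.
have cP (t c d y : R) : 0 < t -> - r <= c -> d <= r -> t <= `|y| -> `|y| <= r ->
    {in `[c, d], continuous (P ^~ y)}.
  move=> t0 rc dr ty yr x; rewrite in_itv/= => xcd.
  have xr : `|x| <= r by rewrite ler_norml; lra.
  have xy : closed_at P Q x y by apply: (PQs t) => //; rewrite ty orbT.
  by have [] := closed_at_continuous xy.
have cQ (t c d x : R) : 0 < t -> - r <= c -> d <= r -> t <= `|x| -> `|x| <= r ->
    {in `[c, d], continuous (Q x)}.
  move=> t0 rc dr tx xr y; rewrite in_itv/= => ycd.
  have yr : `|y| <= r by rewrite ler_norml; lra.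
  have xy : closed_at P Q x y by apply: (PQs t) => //; rewrite tx.
  by have [] := closed_at_continuous xy.
have nr : `|r| = r by rewrite ger0_norm// ltW.
have gbound (t x y : R) : 0 < t -> `|x| <= r -> `|y| <= r ->
    (t <= `|x|) || (t <= `|y|) -> nrm (g (x +i* y) : C) <= M / (t * t).
  move=> t0 xr yr xy; have tz := nz _ _ _ t0 xy.
  have z0 := lt_le_trans t0 tz.
  rewrite nrmM nrmV nrmM ler_pM ?nrm_ge0 ?invr_ge0 ?mulr_ge0 ?nrm_ge0//.
    exact/fM/sq.
  by rewrite lef_pV2 ?posrE ?mulr_gt0// ler_pM// ltW.
(* Four sides of length [2 * r], with [g] bounded by [M / (r * r)] on each. *)
have up : circulation P Q (- r) r (- r) r <= 8 * M / r.
  have PI (y : R) : `|y| = r -> - (M / (r * r)) * (r - - r) <=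
      \int[lebesgue_measure]_(x in `[- r, r]) P x y <= M / (r * r) * (r - - r).
    move=> yr; apply: Rintegral_bounds; [lra|by apply: (cP r); rewrite ?yr|].
    move=> x xr; rewrite -ler_norml; apply: le_trans (nrm_Im _) _.
    by apply: gbound; rewrite ?yr ?lexx ?orbT// ler_norml.
  have QI (x : R) : `|x| = r -> - (M / (r * r)) * (r - - r) <=
      \int[lebesgue_measure]_(y in `[- r, r]) Q x y <= M / (r * r) * (r - - r).
    move=> xr; apply: Rintegral_bounds; [lra|by apply: (cQ r); rewrite ?xr|].
    move=> y yr; rewrite -ler_norml; apply: le_trans (nrm_Re _) _.
    by apply: gbound; rewrite ?xr ?lexx ?orbT// ler_norml.
  have nrN : `|- r| = r by rewrite normrN.
  have := PI _ nr; have := PI _ nrN; have := QI _ nr; have := QI _ nrN.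
  have -> : 8 * M / r = 4 * (M / (r * r) * (r - - r)) by field; rewrite gt_eqF.
  by rewrite /circulation mulNr; lra.
(* On each side of the square of half-side [t], the form [Im (l / z dz)] has, in the direction of
   travel, the density [l * (t / (u ^+ 2 + t ^+ 2))], at least [l / (2 * t)] as [u] stays within
   [t]. A side of length [2 * t] thus gives at least [l]. Replacing [l / z] by [g] costs at most
   [e / t] pointwise, so [2 * e] per side. *)
have low (e : R) : 0 < e -> 4 * l - 8 * e <= circulation P Q (- r) r (- r) r.
  move=> e0; have d0 : nrm (0 : C) < s by rewrite nrm0; lra.
  have [d d00 dP] := differentiable_nrm (fd _ d0) e0.
  (* Points of the square have norm at most [2 * t], which [d / 3] keeps strictly below [d]. *)
  pose t := Num.min r (d / 3).
  have t0 : 0 < t by rewrite lt_min r0 divr_gt0.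
  have tr : t <= r by rewrite ge_min lexx.
  have td : 3 * t <= d by rewrite -ler_pdivlMl// mulrC ge_min lexx orbT.
  rewrite (@circulation_square _ P Q t r)//; last first.
    by move=> x y xr yr xy; exact: (PQs t).
  have near (x y : R) : `|x| <= t -> `|y| <= t -> (t <= `|x|) || (t <= `|y|) ->
      nrm (g (x +i* y) - l%:C / (x +i* y) : C) <= e / t.
    move=> xt yt xy; have tz := nz _ _ _ t0 xy; have z0 := nz0 _ _ t0 tz.
    set z : C := x +i* y in tz z0 *.
    have zd : nrm (z - 0) < d.
      by rewrite subr0; apply: le_lt_trans (nrm_le_ReIm _) _ => /=; lra.
    have := dP _ zd; rewrite f0 !subr0 diff_scalarE ?fl; last exact: fd.
    have -> : g z - l%:C / z = (f z - z * l%:C) / (z * z).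
      by rewrite /g fctE; field.
    rewrite nrmM nrmV nrmM => fz.
    have zn0 : 0 < nrm z := lt_le_trans t0 tz.
    rewrite ler_pdivrMr ?mulr_gt0//; apply: le_trans fz _.
    rewrite mulrA ler_wpM2r ?nrm_ge0//.
    by rewrite mulrAC ler_pdivlMr// ler_wpM2l// ltW.
  have invE (x y : R) : l%:C / (x +i* y : C) =
      (l * (x / (x ^+ 2 + y ^+ 2))) +i* (- (l * (y / (x ^+ 2 + y ^+ 2)))).
    by apply/eqP; rewrite eq_complex /=; apply/andP; split; apply/eqP; ring.
  have core (u : R) : `|u| <= t -> l / (2 * t) <= l * (t / (u ^+ 2 + t ^+ 2)).
    move=> ut; rewrite ler_wpM2l//.
    have t2 : 0 < t ^+ 2 by rewrite exprn_gt0.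
    rewrite ler_pdivlMr; last by rewrite ltr_wpDl ?sqr_ge0.
    rewrite ler_pdivrMl ?mulr_gt0//.
    have : u ^+ 2 <= t ^+ 2 by rewrite -(real_normK (num_real u)) lerXn2r ?nnegrE ?(ltW t0).
    by rewrite -mulrA -expr2; lra.
  have imP (x y : R) : `|x| <= t -> `|y| <= t -> (t <= `|x|) || (t <= `|y|) ->
      `|P x y + l * (y / (x ^+ 2 + y ^+ 2))| <= e / t /\
      `|Q x y - l * (x / (x ^+ 2 + y ^+ 2))| <= e / t.
    move=> xt yt xy; have := near _ _ xt yt xy; rewrite invE => gle.
    split; apply: le_trans gle.
      apply: le_trans (nrm_Im _); rewrite /P; case: (g _) => u v /=.
      by rewrite opprK.
    by apply: le_trans (nrm_Re _); rewrite /Q; case: (g _) => u v /=.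
  have nt : `|t| = t by rewrite ger0_norm// ltW.
  have ntN : `|- t| = t by rewrite normrN.
  pose m := l / (2 * t) - e / t; pose K := M / (t * t).
  have gb (x y : R) : `|x| <= t -> `|y| <= t -> (t <= `|x|) || (t <= `|y|) ->
      nrm (g (x +i* y) : C) <= K.
    by move=> xt yt xy; apply: gbound => //; apply: le_trans tr.
  have Pt (y : R) : `|y| = t -> forall x, - t <= x <= t ->
      [/\ `|P x y + l * (y / (x ^+ 2 + y ^+ 2))| <= e / t, `|P x y| <= K &
         l / (2 * t) <= l * (t / (x ^+ 2 + y ^+ 2))].
    move=> yt x; rewrite -ler_norml => xt.
    have yt' : `|y| <= t by rewrite yt.
    have xy : (t <= `|x|) || (t <= `|y|) by rewrite yt lexx orbT.
    split; [by have [] := imP _ _ xt yt' xy|exact: le_trans (nrm_Im _) (gb _ _ xt yt' xy)|].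
    by have := core _ xt; rewrite -(real_normK (num_real y)) yt.
  have Qt (x : R) : `|x| = t -> forall y, - t <= y <= t ->
      [/\ `|Q x y - l * (x / (x ^+ 2 + y ^+ 2))| <= e / t, `|Q x y| <= K &
         l / (2 * t) <= l * (t / (x ^+ 2 + y ^+ 2))].
    move=> xt y; rewrite -ler_norml => yt.
    have xt' : `|x| <= t by rewrite xt.
    have xy : (t <= `|x|) || (t <= `|y|) by rewrite xt lexx.
    split; [by have [] := imP _ _ xt' yt xy|exact: le_trans (nrm_Re _) (gb _ _ xt' yt xy)|].
    by have := core _ yt; rewrite -(real_normK (num_real x)) xt addrC.
  have tt : - t <= t by lra.
  have rt : - r <= - t by lra.
  have nty : t <= `|t| by rewrite nt.
  have ntyN : t <= `|- t| by rewrite ntN.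
  have /andP[I1 _] : m * (t - - t) <= \int[lebesgue_measure]_(x in `[- t, t]) P x (- t)
      <= K * (t - - t).
    apply: Rintegral_bounds => //; first by apply: (cP t); rewrite ?ntN.
    move=> x /(Pt _ ntN)[]; rewrite mulNr mulrN /m !ler_norml.
    set v := l / (2 * t); set u := l * _; set w := e / t; lra.
  have /andP[_ I2] : - K * (t - - t) <= \int[lebesgue_measure]_(x in `[- t, t]) P x t
      <= - m * (t - - t).
    apply: Rintegral_bounds => //; first by apply: (cP t); rewrite ?nt.
    move=> x /(Pt _ nt)[]; rewrite /m !ler_norml.
    set v := l / (2 * t); set u := l * _; set w := e / t; lra.
  have /andP[I3 _] : m * (t - - t) <= \int[lebesgue_measure]_(y in `[- t, t]) Q t y
      <= K * (t - - t).
    apply: Rintegral_bounds => //; first by apply: (cQ t); rewrite ?nt.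
    move=> x /(Qt _ nt)[]; rewrite /m !ler_norml.
    set v := l / (2 * t); set u := l * _; set w := e / t; lra.
  have /andP[_ I4] : - K * (t - - t) <= \int[lebesgue_measure]_(y in `[- t, t]) Q (- t) y
      <= - m * (t - - t).
    apply: Rintegral_bounds => //; first by apply: (cQ t); rewrite ?ntN.
    move=> x /(Qt _ ntN)[]; rewrite mulNr mulrN opprK /m !ler_norml.
    set v := l / (2 * t); set u := l * _; set w := e / t; lra.
  have -> : 4 * l - 8 * e = 4 * (m * (t - - t)) by rewrite /m; field; rewrite gt_eqF.
  move: I1 I2 I3 I4; rewrite /circulation mulNr; set X := m * _; lra.
have ler (e : R) : 0 < e -> l <= 2 * M / r + e.
  move=> e0; have e20 : 0 < e / 2 by rewrite divr_gt0.
  have := le_trans (low _ e20) up.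
  have -> : 8 * M / r = 4 * (2 * M / r) by field; rewrite gt_eqF.
  by lra.
exact/ler_addgt0Pr.
Qed.

End cauchy_estimate.

Section cauchy_estimate_vector.
Context {R : realType}.
Local Notation C := (R[i]^o).

(** Subtracting [f 0] and multiplying by the conjugate of [l] makes the derivative at 0 equal to
    [nrm l ^+ 2], a nonnegative real, at the price of the bound [nrm l * (2 * M)]. The previous
    estimate at half-side [r / 3] then gives 12 after division by [nrm l]. *)
Lemma cauchy_estimate (f : C -> C) (r M : R) : 0 < r ->
  (forall z, nrm z < r -> differentiable f z) ->
  (forall z, nrm z < r -> nrm (f z) <= M) ->
  nrm ('d f 0 1 : C) <= 12 * M / r.
Proof.
move=> r0 fd fM; pose l : C := 'd f 0 1.
have d0 : differentiable f 0 by apply: fd; rewrite nrm0.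
have [l0|l0] := eqVneq l 0.
  rewrite -/l l0 nrm0 mulr_ge0 ?invr_ge0 ?(ltW r0)// mulr_ge0//.
  by apply: le_trans (nrm_ge0 (f 0)) (fM _ _); rewrite nrm0.
have nl0 : 0 < nrm l.
  by rewrite lt_neqAle nrm_ge0 andbT eq_sym; apply: contraNneq l0 => /nrm0_eq0 ->.
have nJ : nrm (l^*%C : C) = nrm l by rewrite /nrm normcJ.
pose g : C -> C := (l^*%C : R[i]) *: (f - cst (f 0)).
have gd z : nrm z < r -> differentiable g z.
  move=> zr; apply: differentiableZ.
  by apply: differentiableB; [exact: fd|exact: differentiable_cst].
have gM z : nrm z < r -> nrm (g z) <= nrm l * (2 * M).
  move=> zr; rewrite nrmZ nJ ler_wpM2l ?nrm_ge0// (le_trans (nrmD _ _))// nrmN.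
  have := fM _ zr; have : nrm (f 0) <= M by apply: fM; rewrite nrm0.
  rewrite /cst; lra.
have g0 : g 0 = 0 by rewrite /g !fctE subrr scaler0.
have gl : 'd g 0 1 = (nrm l ^+ 2)%:C.
  have cd : differentiable (cst (f 0) : C -> C) (0 : C) by exact: differentiable_cst.
  rewrite diffZ; last exact: differentiableB.
  rewrite (_ : (_ \*: _) 1 = l^*%C * 'd (f - cst (f 0)) (0 : C) 1)//.
  rewrite (diffB d0 cd).
  rewrite (_ : ('d f 0 \- _) 1 = l - 'd (cst (f 0)) (0 : C) 1)//.
  rewrite diff_cst.
  rewrite (_ : (0 : C -> C) 1 = 0)//.
  rewrite subr0.
  rewrite rmorphXn.
  rewrite -[RHS]/((nrm l)%:C ^+ 2).
  rewrite nrmE.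
  rewrite sqr_normc.
  exact: mulrC.
have r30 : 0 < r / 3 by rewrite divr_gt0.
have r3 : 2 * (r / 3) < r by lra.
have := cauchy_estimate_pos r30 r3 gd gM g0 gl (sqr_ge0 _).
have -> : 2 * (nrm l * (2 * M)) / (r / 3) = (12 * M / r) * nrm l.
  by field; rewrite gt_eqF.
by rewrite expr2 ler_pM2r.
Qed.

(** * Mean value inequality and second-order Taylor estimate *)

Section mean_value.
Context {V W : normedModType R[i]}.

(** Differentiability at [t] controls the increments over short intervals containing [t], with slope
    [K + e]. Bisection glues these local bounds together without integrating the derivative, and [e]
    is arbitrary. *)
Lemma mean_value_inequality (f : V -> W) (z h : V) (K : R) :
  (forall t : R, 0 <= t <= 1 -> differentiable f (z + t%:C *: h) /\
     nrm ('d f (z + t%:C *: h) h) <= K) ->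
  nrm (f (z + h) - f z) <= K.
Proof.
move=> fK; have K0 : 0 <= K.
  by apply: le_trans (nrm_ge0 _) (fK 0 _).2; rewrite lexx ler01.
pose p (t : R) := f (z + t%:C *: h).
have pE : f (z + h) - f z = p 1 - p 0 by rewrite /p scale1r scale0r addr0.
apply/ler_addgt0Pr => e e0; rewrite pE.
suff : nrm (p 1 - p 0) <= (K + e) * (1 - 0) by rewrite subr0 mulr1.
(* Bisection of the parameter interval; the second interval is a point. *)
apply: (@rectangle_induction R
  (fun a b _ _ => nrm (p b - p a) <= (K + e) * (b - a)) 0 1 0 0) => //.
  move=> a b c d _ _ _ _ _ _; set m := (a + b) / 2 => am mb _ _.
  have -> : p b - p a = (p b - p m) + (p m - p a) by rewrite subrKA.
  have -> : (K + e) * (b - a) = (K + e) * (b - m) + (K + e) * (m - a) by ring.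
  by rewrite (le_trans (nrmD _ _))// lerD.
move=> t y t01 _; have [fd fK'] := fK _ t01.
have h1 : 0 < nrm h + 1 by rewrite ltr_wpDl ?nrm_ge0.
have [r r0 rP] := differentiable_nrm fd (divr_gt0 e0 h1).
exists (r / (nrm h + 1)); first by rewrite divr_gt0.
(* The derivative contributes the slope [K], and the slack [e] absorbs the remainder, which is at
   most [e / (nrm h + 1)] times [|s - t| * nrm h]. The added 1 allows [h = 0]. *)
have near s : `|s - t| < r / (nrm h + 1) -> nrm (p s - p t) <= (K + e) * `|s - t|.
  move=> st; have stE : z + s%:C *: h - (z + t%:C *: h) = (s - t)%:C *: h.
    by rewrite opprD addrACA subrr add0r -scalerBl rmorphB.
  have nst : nrm ((s - t)%:C *: h) = `|s - t| * nrm h by rewrite nrmZ nrm_real.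
  have := rP (z + s%:C *: h); rewrite stE nst.
  have sr : `|s - t| * nrm h < r.
    move: st; rewrite ltr_pdivlMr//; apply: le_lt_trans.
    by rewrite ler_wpM2l// lerDl.
  move=> /(_ sr) le1; rewrite -(subrK ('d f (z + t%:C *: h) ((s - t)%:C *: h)) (p s - p t)).
  rewrite (le_trans (nrmD _ _))// mulrDl addrC lerD//.
    by rewrite linearZ /= nrmZ nrm_real mulrC ler_wpM2r.
  apply: le_trans le1 _; rewrite mulrCA mulrC ler_wpM2r//.
  by rewrite mulrAC ler_pdivrMr// ler_wpM2l ?(ltW e0)// lerDl.
move=> a b c d _ at_ tb _ _ _ _ _ ba _.
have na : `|a - t| = t - a by rewrite distrC ger0_norm// subr_ge0.
have nb : `|b - t| = b - t by rewrite ger0_norm// subr_ge0.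
have -> : p b - p a = (p b - p t) + (p t - p a) by rewrite subrKA.
have -> : (K + e) * (b - a) = (K + e) * (b - t) + (K + e) * (t - a) by ring.
rewrite (le_trans (nrmD _ _))// lerD//; first by rewrite -nb near// nb; lra.
by rewrite nrmB -na near// na; lra.
Qed.

End mean_value.

Section second_order.
Context {V : normedModType R[i]}.
Implicit Types (f : V -> C) (x y h : V).

(** The one-variable estimate on the complex line through [x] in the direction [h], where the ball
    cuts out a disc of radius [r / nrm h]. *)
Lemma cauchy_estimate_dir f x (r M : R) : 0 < r ->
  (forall y, nrm (y - x) < r -> differentiable f y) ->
  (forall y, nrm (y - x) < r -> nrm (f y) <= M) ->
  forall h, nrm ('d f x h : C) <= 12 * M / r * nrm h.
Proof.
move=> r0 fd fM h; have [->|h0] := eqVneq h 0.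
  by rewrite linear0 !nrm0 mulr0.
have nh0 : 0 < nrm h.
  by rewrite lt_neqAle nrm_ge0 andbT eq_sym; apply: contraNneq h0 => /nrm0_eq0 ->.
pose l (z : C) : V := z *: h + x.
have ld z : is_diff z l (fun z : C => z *: h).
  have -> : l = (fun z : C => z *: h) + cst x by [].
  by apply: is_diff_eq; rewrite addr0.
have lx z : nrm z < r / nrm h -> nrm (l z - x) < r.
  by rewrite /l addrK nrmZ -ltr_pdivlMr.
have gd z : nrm z < r / nrm h -> differentiable (f \o l) z.
  by move=> /lx/fd fz; apply: differentiable_comp => //; exact: ex_diff.
have gM z : nrm z < r / nrm h -> nrm ((f \o l) z) <= M by move=> /lx/fM.
have := cauchy_estimate (divr_gt0 r0 nh0) gd gM.
have l0 : l 0 = x by rewrite /l scale0r add0r.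
rewrite diff_comp; last 2 first.
- exact: ex_diff.
- by rewrite l0; apply: fd; rewrite subrr nrm0.
rewrite /= diff_val l0 scale1r => /le_trans; apply.
by rewrite invfM invrK mulrA.
Qed.

(** The half-ball is convex, and each point of the segment from [y] to [z] is the center of a ball
    of radius [r / 2] on which [M] still bounds [f]. The directional estimate there has the constant
    [12 * M / (r / 2)]. *)
Lemma ball_lipschitz f x (r M : R) : 0 < r ->
  (forall y, nrm (y - x) < r -> differentiable f y) ->
  (forall y, nrm (y - x) < r -> nrm (f y) <= M) ->
  forall y z, nrm (y - x) < r / 2 -> nrm (z - x) < r / 2 ->
  nrm (f z - f y) <= 24 * M / r * nrm (z - y).
Proof.
move=> r0 fd fM y z yx zx.
have -> : z = y + (z - y) by rewrite addrC subrK.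
rewrite addrAC subrr add0r.
apply: mean_value_inequality => t /andP[t0 t1].
have wx : nrm (y + t%:C *: (z - y) - x) < r / 2.
  have -> : y + t%:C *: (z - y) - x = (1 - t)%:C *: (y - x) + t%:C *: (z - x).
    rewrite rmorphB /= scalerBl scale1r -[RHS]addrA [- (_ *: _) + _]addrC.
    by rewrite -scalerBr opprB subrKA addrAC.
  rewrite (le_lt_trans (nrmD _ _))// !nrmZ !nrm_real !ger0_norm ?subr_ge0//.
  have [->|t'] := eqVneq t 0; first by rewrite subr0 mul1r mul0r addr0.
  have {}t0 : 0 < t by rewrite lt_neqAle eq_sym t'.
  have -> : r / 2 = (1 - t) * (r / 2) + t * (r / 2) by ring.
  by rewrite ler_ltD ?ltr_pM2l// ler_wpM2l ?subr_ge0// ltW.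
set w := y + t%:C *: (z - y) in wx *; have ww u : nrm (u - w) < r / 2 -> nrm (u - x) < r.
  move=> uw; have -> : u - x = (u - w) + (w - x) by rewrite subrKA.
  by apply: le_lt_trans (nrmD _ _) _; rewrite [r]splitr ltrD.
have r20 : 0 < r / 2 by rewrite divr_gt0.
split; first by apply: fd; apply: lt_trans wx _; lra.
have := cauchy_estimate_dir r20 (fun u uw => fd u (ww u uw)) (fun u uw => fM u (ww u uw)).
move=> /(_ (z - y)) /le_trans; apply.
by have -> : 12 * M / (r / 2) = 24 * M / r by field; rewrite gt_eqF.
Qed.

(** Second derivatives are avoided by applying the Cauchy estimate to the difference of [f] and its
    translate by [v = y - x]. On the ball of radius [r / 4] this difference is at most
    [24 * M / r * nrm v], and [12 * 24 * 4 = 1152]. *)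
Lemma diff_lipschitz f x (r M : R) : 0 < r ->
  (forall y, nrm (y - x) < r -> differentiable f y) ->
  (forall y, nrm (y - x) < r -> nrm (f y) <= M) ->
  forall y h, nrm (y - x) < r / 4 ->
  nrm ('d f y h - 'd f x h : C) <= 1152 * M / r ^+ 2 * nrm (y - x) * nrm h.
Proof.
move=> r0 fd fM y h yx; pose v := y - x.
have sd u : is_diff u (fun u => u + v) id.
  have -> : (fun u => u + v) = id + cst v by [].
  by apply: is_diff_eq; rewrite addr0.
pose g : V -> C := (f \o (fun u => u + v)) - f.
have uv u : nrm (u - x) < r / 4 -> nrm (u + v - x) < r / 2.
  by move=> ux; rewrite addrAC (le_lt_trans (nrmD _ _))// /v; lra.
have fdv u : nrm (u - x) < r / 4 -> differentiable (f \o (fun u => u + v)) u.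
  move=> /uv uvx; apply: differentiable_comp; first exact: ex_diff.
  by apply: fd; lra.
have gd u : nrm (u - x) < r / 4 -> differentiable g u.
  by move=> ux; apply: differentiableB; [exact: fdv|apply: fd; lra].
have gM u : nrm (u - x) < r / 4 -> nrm (g u) <= 24 * M / r * nrm v.
  move=> ux; have := ball_lipschitz r0 fd fM _ (uv u ux).
  move=> /(_ u); rewrite addrAC subrr add0r; apply; lra.
have r40 : 0 < r / 4 by rewrite divr_gt0.
have xx : nrm (x - x) < r / 4 by rewrite subrr nrm0.
have xr : nrm (x - x) < r by rewrite subrr nrm0.
have xvE : x + v = y by rewrite /v addrC subrK.
have fxv : differentiable f (x + v) by rewrite xvE; apply: fd; lra.
have sdx : differentiable (fun u => u + v) x by exact: ex_diff.
have gE : 'd g x h = 'd f y h - 'd f x h :> C.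
  have gE := congr1 (@^~ h) (diffB (fdv _ xx) (fd _ xr)).
  have cE := congr1 (@^~ h) (diff_comp sdx fxv).
  apply: etrans gE _; congr (_ - _); apply: etrans cE _ => /=.
  by rewrite (@diff_val _ _ _ _ _ _ _ (sd x)) xvE.
rewrite -gE; apply: le_trans (cauchy_estimate_dir r40 gd gM h) _.
rewrite le_eqVlt; apply/orP; left; apply/eqP; rewrite /v.
by field; rewrite gt_eqF.
Qed.

(** The mean value inequality for [f] minus its differential at [x]: along the segment the
    derivative of this map is the variation of ['d f], which [diff_lipschitz] controls. *)
Lemma taylor1 f x (r M : R) : 0 < r ->
  (forall y, nrm (y - x) < r -> differentiable f y) ->
  (forall y, nrm (y - x) < r -> nrm (f y) <= M) ->
  forall h, nrm h < r / 4 ->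
  nrm (f (x + h) - f x - 'd f x h : C) <= 1152 * M / r ^+ 2 * nrm h ^+ 2.
Proof.
move=> r0 fd fM h hr.
have xx : nrm (x - x) < r by rewrite subrr nrm0.
have dc : continuous ('d f x) := diff_continuous (fd _ xx).
pose g : V -> C := f - ('d f x : V -> C).
have -> : f (x + h) - f x - 'd f x h = g (x + h) - g x.
  rewrite /g !fctE linearD; move: (f (x + h)) (f x) ('d f x x) ('d f x h) => a b c e.
  by rewrite opprD opprB [c - b]addrC addrACA [- c - e + c]addrAC addNr sub0r.
apply: mean_value_inequality => t /andP[t0 t1].
have th : nrm (x + t%:C *: h - x) <= nrm h.
  by rewrite addrAC subrr add0r nrmZ nrm_real ger0_norm// ler_piMl ?nrm_ge0.
have fdt : differentiable f (x + t%:C *: h) by apply: fd; lra.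
have dd : differentiable ('d f x) (x + t%:C *: h) by exact: linear_differentiable.
split; first exact: differentiableB.
have gE : 'd g (x + t%:C *: h) h = 'd f (x + t%:C *: h) h - 'd f x h :> C.
  have gE := congr1 (@^~ h) (diffB fdt dd).
  apply: etrans gE _; congr (_ - _).
  exact: (congr1 (@^~ h) (diff_lin (x + t%:C *: h) dc)).
rewrite gE; apply: le_trans (diff_lipschitz r0 fd fM _ _) _; first lra.
have M0 : 0 <= M by apply: le_trans (nrm_ge0 (f x)) (fM _ xx).
have K0 : 0 <= 1152 * M / r ^+ 2.
  apply: divr_ge0; last by apply: exprn_ge0; exact: ltW.
  by rewrite mulr_ge0 ?ler0n ?M0.
rewrite [nrm h ^+ 2]expr2 mulrA; apply: ler_wpM2r; first exact: nrm_ge0.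
exact: ler_wpM2l.
Qed.

End second_order.
End cauchy_estimate_vector.

(** * Holomorphy of Delta *)

Section Delta_holomorphic.
Context {R : realType} {E : banach R} (U : wopen E).
Local Notation C := (R[i]^o).

Lemma valL_val (F : banach R) (f : U -> F) (x : U) :
  'valL_(0 : F) f (set_val x) = f x.
Proof. exact: (congr1 (@^~ x) (valLK (0 : F) f)). Qed.

Lemma wopen_nbhs (x : U) : exists2 r : R, 0 < r &
  forall y : E, nrm (y - set_val x) < r ->
    exists2 y' : U, set_val y' = y & weight x / 2 <= weight y'.
Proof.
have w2 : 0 < weight x / 2 by rewrite divr_gt0 ?weight_gt0.
have /cvgrPdist_lt/(_ _ w2) := @weight_continuous _ _ U x.
move=> wx; have {wx} : nbhs x (fun y : U => `|weight x - weight y| < weight x / 2) by exact: wx.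
rewrite nbhsE => -[_ [[A oA <-] /= Ax] AP].
have Ux : wset U (set_val x) by exact: set_valP.
have /nbhs_ballP[_ /= /complex_e2[r r0 <-] rP] : nbhs (set_val x) (A `&` wset U).
  by apply: open_nbhs_nbhs; split => //; apply: openI => //; exact: wset_open.
exists r => // y yx.
have [Ay Uy] : (A `&` wset U) y.
  by apply: rP; rewrite -ball_normE /= -nrm_lt nrmB.
exists (SigSub (mem_set Uy)) => //.
have := AP (SigSub (mem_set Uy)) Ay; rewrite /= ltr_norml; lra.
Qed.

(** The radius is chosen before [f], and the bound involves [f] only through [wnorm f]. This
    uniformity is what turns Taylor estimates for scalar functions into estimates in the dual
    norm. *)
Lemma hv_ball (x : U) : exists2 r : R, 0 < r &
  forall y : E, nrm (y - set_val x) < r -> forall f : hv U (cplx R),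
    differentiable ('valL_(0 : C) f) y /\
    nrm ('valL_(0 : C) f y : C) <= 2 / weight x * wnorm f.
Proof.
have [r r0 rP] := wopen_nbhs x; exists r => // y /rP[y' <- xy'] f.
have [hf bf] := hvE f; split; first exact: hf.
rewrite (valL_val f); have := wnormP y' (hvE f).
rewrite -(invf_div (weight x) 2) ler_pdivlMl ?divr_gt0 ?weight_gt0//.
by apply: le_trans; apply: ler_wpM2r => //; exact: nrm_ge0.
Qed.

Lemma valL_linear (a : R[i]) (f g : hv U (cplx R)) :
  'valL_(0 : C) (a *: f + g : hv U (cplx R)) =
  a *: ('valL_(0 : C) f : E -> C) + 'valL_(0 : C) g.
Proof.
apply/funext => y; rewrite /valL_ !fctE /=.
by case: ('oinv_set_val y) => //=; rewrite scaler0 addr0.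
Qed.

Let D (x : U) (h : E) (f : hv U (cplx R)) : cplx R := 'd ('valL_(0 : C) f) (set_val x : E) h.

Let hv_diff (x : U) (f : hv U (cplx R)) :
  differentiable ('valL_(0 : C) f) (set_val x).
Proof. by have [hf _] := hvE f; exact: hf. Qed.

Lemma derivation_bound (x : U) : exists2 K : R, 0 <= K &
  forall h f, nrm (D x h f) <= K * nrm h * wnorm f.
Proof.
have [r r0 rP] := hv_ball x; exists (24 / (r * weight x)).
  by rewrite divr_ge0// mulr_ge0 ?(ltW r0)// ltW// weight_gt0.
move=> h f; have fd y yx := (rP y yx f).1; have fM y yx := (rP y yx f).2.
apply: le_trans (cauchy_estimate_dir r0 fd fM h) _.
rewrite le_eqVlt; apply/orP; left; apply/eqP; field.
by rewrite !gt_eqF ?weight_gt0.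
Qed.

Lemma derivation_subproof (x : U) (h : E) : D x h \in bop_pred (hv U (cplx R)) (cplx R).
Proof.
have Dlin : linear (D x h).
  move=> a f g; rewrite /D valL_linear.
  have dZ : differentiable (a *: ('valL_(0 : C) f : E -> C)) (set_val x).
    by apply: differentiableZ; exact: hv_diff.
  have dE := congr1 (@^~ h) (diffD dZ (hv_diff x g)).
  apply: etrans dE _; congr (_ + _).
  exact: (congr1 (@^~ h) (diffZ a (hv_diff x f))).
apply/asboolP; split=> //.
pose DL : {linear hv U (cplx R) -> cplx R} :=
  HB.pack (D x h) (GRing.isLinear.Build R[i] _ _ _ (D x h) Dlin).
suff : continuous DL by [].
have [K K0 DK] := derivation_bound x.
apply: bounded_linear_continuous; apply/linear_boundedP.
exists (K * nrm h)%:C; split; first by apply/complex_realP; eexists.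
move=> M xM f; apply: (@le_trans _ _ ((K * nrm h)%:C * `|f|)); last first.
  by rewrite ler_wpM2r// ltW.
by rewrite -(nrmE (DL f)) -(nrmE f) -rmorphM/= lecR nrm_hv; exact: DK.
Qed.

(** The candidate for the derivative of [Delta] at [x] in the direction [h], so far only an element
    of the dual. *)
Definition derivation (x : U) (h : E) : dual U := Bop (derivation_subproof x h).

Lemma dirac_taylor (x : U) : exists r K : R, [/\ 0 < r, 0 <= K &
  forall y h, set_val y = set_val x + h -> nrm h < r ->
    nrm (dirac y - dirac x - derivation x h) <= K * nrm h ^+ 2].
Proof.
have [r r0 rP] := hv_ball x.
have K0 : 0 <= 1152 * (2 / weight x) / r ^+ 2.
  have w0 : 0 <= 2 / weight x by apply: divr_ge0; [exact: ler0n|exact/ltW/weight_gt0].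
  by apply: divr_ge0; [rewrite mulr_ge0 ?ler0n|apply: exprn_ge0; exact: ltW].
exists (r / 4), (1152 * (2 / weight x) / r ^+ 2); split; [by rewrite divr_gt0|exact: K0|].
move=> y h yx hr; rewrite nrm_bop; apply: opnorm_le.
  by apply: mulr_ge0; [exact: K0|apply: exprn_ge0; exact: nrm_ge0].
move=> f; have fd y yx := (rP y yx f).1; have fM y yx := (rP y yx f).2.
have := taylor1 r0 fd fM hr; rewrite -yx (valL_val f y) (valL_val f x) nrm_hv => /le_trans.
rewrite [X in X <= _]/nrm /= -/(nrm _); apply.
rewrite le_eqVlt; apply/orP; left; apply/eqP; field.
by rewrite !gt_eqF ?weight_gt0.
Qed.

End Delta_holomorphic.

Section Delta_Hv.
Context {R : realType} {E : banach R}.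
Implicit Types (U : wopen E) (F G : banach R).

Lemma Hv_comp U F G (T : bop F G) (g : U -> F) : Hv U F g -> Hv U G (T \o g).
Proof.
move=> Hg; have [hg bg] := Hg; split.
  have vE : 'valL_(0 : G) (T \o g) = T \o 'valL_(0 : F) g.
    apply/funext => y; rewrite /valL_ /=.
    by case: ('oinv_set_val y) => //=; rewrite linear0.
  move=> x; rewrite vE; apply: differentiable_comp; first exact: hg.
  by apply: linear_differentiable; exact: bop_continuous.
exists (opnorm T * wnorm g) => _ [x _ <-].
apply: (@le_trans _ _ (weight x * (opnorm T * nrm (g x)))).
  by apply: ler_wpM2l; [exact/ltW/weight_gt0|exact: opnormP].
by rewrite mulrCA; apply: ler_wpM2l; [exact: opnorm_ge0|exact: wnormP].
Qed.

Section fixed_open.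
Context (U : wopen E).

Lemma derivation_linear (x : U) : linear (derivation x).
Proof.
by move=> a h k; apply: bop_ext => f; exact: (@linearP _ _ _ _ ('d _ _)).
Qed.

(** By [dirac_taylor] the functional is the norm limit of the difference quotients
    [t^-1 *: (dirac y - dirac x)] with [y = x + t *: h], which lie in the span of the
    evaluations. *)
Lemma derivation_cspan (x : U) h : derivation x h \in cspan_pred (range (@dirac _ _ U)).
Proof.
have [r [K [r0 K0 rP]]] := dirac_taylor x.
have [s s0 sP] := wopen_nbhs x.
apply/asboolP; apply: closed_closure; apply/nrm_closure => d d0.
pose a := nrm h + K * nrm h ^+ 2 + 1.
have Kh0 : 0 <= K * nrm h ^+ 2 by apply: mulr_ge0 => //; exact: sqr_ge0.
have nh0 := nrm_ge0 h.
have a0 : 0 < a by rewrite /a; lra.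
pose m := Num.min r (Num.min s d).
have m0 : 0 < m by rewrite !lt_min r0 s0.
have [mr ms md] : [/\ m <= r, m <= s & m <= d].
  by rewrite /m !ge_min !lexx !orbT.
(* As [a] exceeds both [nrm h] and [K * nrm h ^+ 2], this single [t] keeps the step [t *: h] within
   the two radii [r] and [s], and the error [t * (K * nrm h ^+ 2)] of the quotient below [d]. *)
pose t := m / a; have t0 : 0 < t by rewrite divr_gt0.
have tlt b : b < a -> t * b < m.
  by move=> ba; rewrite mulrAC ltr_pdivrMr// ltr_pM2l.
have nth : nrm (t%:C *: h) = t * nrm h by rewrite nrmZ nrm_real gtr0_norm.
have th : nrm (t%:C *: h) < m by rewrite nth; apply: tlt; rewrite /a; lra.
have [|y yE _] := sP (set_val x + t%:C *: h).
  by rewrite addrAC subrr add0r; lra.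
have := rP y _ yE (lt_le_trans th mr).
have -> : derivation x (t%:C *: h) = t%:C *: derivation x h.
  have := derivation_linear x t%:C h 0; rewrite addr0.
  have -> : derivation x 0 = 0.
    by apply: bop_ext => f; exact: (@linear0 _ _ _ _ ('d _ _)).
  by rewrite addr0.
have tC0 : t%:C != 0 by rewrite -(rmorph0 (real_complex R)) (inj_eq (@complexI R)) gt_eqF.
move=> le1; exists (t%:C^-1 *: (dirac y - dirac x)).
  suff /asboolP : t%:C^-1 *: (dirac y - dirac x) \in cspan_pred (range (@dirac _ _ U)) by [].
  by rewrite rpredZ// rpredB// Delta_subproof.
have -> : derivation x h - t%:C^-1 *: (dirac y - dirac x) =
    (- t%:C^-1) *: (dirac y - dirac x - t%:C *: derivation x h).
  by rewrite [RHS]scalerBr scalerA scaleNr mulNr mulVf// scaleN1r opprK addrC.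
rewrite nrmZ nrmN nrmV nrm_real gtr0_norm// ltr_pdivrMl//.
apply: le_lt_trans le1 _; rewrite nth.
have -> : K * (t * nrm h) ^+ 2 = t * (t * (K * nrm h ^+ 2)) by ring.
by rewrite ltr_pM2l//; apply: lt_le_trans md; apply: tlt; rewrite /a; lra.
Qed.

Definition diff_Delta (x : U) h : predual U := CSpan (derivation_cspan x h).

Lemma diff_Delta_linear (x : U) : linear (diff_Delta x).
Proof. by move=> a h k; apply: val_inj; exact: derivation_linear. Qed.

Lemma weight_Delta (x : U) : weight x * nrm (Delta x) <= 1.
Proof.
rewrite -ler_pdivlMl ?weight_gt0// mulr1 nrm_cspan nrm_bop.
apply: opnorm_le; first by rewrite invr_ge0 ltW// weight_gt0.
by move=> f; rewrite nrm_hv ler_pdivlMl ?weight_gt0//; exact: (wnormP x (hvE f)).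
Qed.

Lemma Hv_Delta : Hv U (predual U) (@Delta _ _ U).
Proof.
split=> [x|].
  pose L : {linear E -> predual U} :=
    HB.pack (diff_Delta x) (GRing.isLinear.Build R[i] _ _ _ _ (diff_Delta_linear x)).
  suff [] : differentiable ('valL_(0 : predual U) (@Delta _ _ U)) (set_val x) /\
    'd ('valL_(0 : predual U) (@Delta _ _ U)) (set_val x) = L :> (E -> predual U) by [].
  apply: nrm_differentiable.
    have [K K0 DK] := derivation_bound x.
    apply: bounded_linear_continuous; apply/linear_boundedP.
    exists K%:C; split; first by apply/complex_realP; eexists.
    move=> M xM h; apply: (@le_trans _ _ (K%:C * `|h|)); last by rewrite ler_wpM2r// ltW.
    rewrite -(nrmE (L h)) -(nrmE h) -rmorphM/= lecR nrm_cspan nrm_bop.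
    by apply: opnorm_le; [rewrite mulr_ge0 ?nrm_ge0|move=> f; rewrite nrm_hv; exact: DK].
  have [r [K [r0 K0 rP]]] := dirac_taylor x.
  have [s s0 sP] := wopen_nbhs x.
  move=> e e0; have K1 : 0 < K + 1 by rewrite ltr_wpDl.
  exists (Num.min r (Num.min s (e / (K + 1)))); first by rewrite !lt_min r0 s0 divr_gt0.
  move=> y; rewrite !lt_min => /and3P[yr ys ye].
  have [y' y'E _] := sP _ ys; rewrite -{y ys}y'E in yr ye *.
  rewrite !valL_val nrm_cspan.
  have yE : set_val y' = set_val x + (set_val y' - set_val x) by rewrite addrC subrK.
  apply: le_trans (rP _ _ yE _) _; first exact: yr.
  move: ye; set n := nrm _; rewrite ltr_pdivlMr// => ye.
  have n0 : 0 <= n := nrm_ge0 _.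
  by rewrite expr2 mulrA ler_wpM2r// mulrC (le_trans _ (ltW ye))// ler_wpM2l// lerDl.
by exists 1 => _ [x _ <-]; exact: weight_Delta.
Qed.

Lemma wnorm_Delta : wnorm (@Delta _ _ U) <= 1.
Proof. by apply: wnorm_le => // x; exact: weight_Delta. Qed.

End fixed_open.
End Delta_Hv.

(** * The Hahn-Banach theorem *)

Section hahn_banach.
Context {R : realType} {V : normedModType R[i]}.
Implicit Types (x y : V) (G : set (V * R)%type).

(* Graphs of partial real-linear functionals dominated by the norm; being
   single-valued is a consequence of the other conditions. *)
Definition dominated_graph G :=
  [/\ forall p q, G p -> G q -> G (p.1 + q.1, p.2 + q.2),
      forall (a : R) p, G p -> G (a%:C *: p.1, a * p.2) &
      forall p, G p -> p.2 <= nrm p.1].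

Lemma dominated_graph_line y :
  dominated_graph [set (a%:C *: y, a * nrm y) | a in [set: R]].
Proof.
split.
- move=> _ _ [a _ <-] [b _ <-]; exists (a + b) => //=.
  by rewrite rmorphD /= scalerDl mulrDl.
- by move=> a _ [b _ <-]; exists (a * b) => //=; rewrite rmorphM /= scalerA mulrA.
- by move=> _ [a _ <-] /=; rewrite nrmZ nrm_real ler_wpM2r ?nrm_ge0// ler_norm.
Qed.

(** The value [t] at [x0] has to lie above every [p.2 - nrm (p.1 - x0)] and below every
    [nrm (p.1 + x0) - p.2]. The triangle inequality separates the two families, so the supremum of
    the first will do; other multiples of [x0] follow by positive homogeneity. *)
Lemma dominated_graph_extend G x0 : dominated_graph G -> G (0, 0) ->
  exists t, dominated_graph
    [set (p.1.1 + p.2%:C *: x0, p.1.2 + p.2 * t) | p in G `*` [set: R]].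
Proof.
move=> [GD GZ Gle] G0.
pose S := [set p.2 - nrm (p.1 - x0) | p in G].
have Sub p : G p -> ubound S (nrm (p.1 + x0) - p.2).
  move=> Gp _ [q Gq <-]; have := Gle _ (GD _ _ Gp Gq) => /=.
  have : nrm (p.1 + q.1) <= nrm (p.1 + x0) + nrm (q.1 - x0).
    by rewrite (le_trans _ (nrmD _ _))// addrACA subrr addr0.
  lra.
have Sne : S !=set0 by exists (0 - nrm (0 - x0)), (0, 0).
have t1 p : G p -> p.2 + sup S <= nrm (p.1 + x0).
  by move=> Gp; rewrite addrC -lerBrDr; apply: ge_sup => //; exact: Sub.
have t2 p : G p -> p.2 - sup S <= nrm (p.1 - x0).
  move=> Gp; rewrite lerBlDr addrC -lerBlDr; apply: sup_upper_bound; last by exists p.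
  by split=> //; exists (nrm (0 + x0) - 0); exact: (Sub _ G0).
exists (sup S); split.
- move=> _ _ [[p a] [/= Gp _] <-] [[q b] [/= Gq _] <-].
  exists ((p.1 + q.1, p.2 + q.2), a + b) => /=; first by split => //; exact: GD.
  by rewrite rmorphD /= scalerDl mulrDl addrACA [X in (_, X)]addrACA.
- move=> c _ [[p a] [/= Gp _] <-].
  exists ((c%:C *: p.1, c * p.2), c * a) => /=; first by split => //; exact: GZ.
  by rewrite rmorphM /= scalerDr scalerA mulrDr mulrA.
- move=> _ [[p a] [/= Gp _] <-] /=.
  have [a0|a0|->] := ltgtP a 0; last first.
  + by rewrite scale0r addr0 mul0r addr0; exact: Gle.
  + have aC0 : a%:C != 0 by rewrite (inj_eq (@complexI R)) gt_eqF.
    have := t1 _ (GZ a^-1 _ Gp); rewrite /= -(ler_pM2l a0) mulrDr mulVKf ?gt_eqF//.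
    move=> /le_trans; apply; rewrite -[X in X * _]gtr0_norm// -nrm_real -nrmZ.
    by rewrite scalerDr scalerA -rmorphM /= divff ?gt_eqF// scale1r.
  + have b0 : 0 < - a by rewrite oppr_gt0.
    have := t2 _ (GZ (- a)^-1 _ Gp); rewrite /= -(ler_pM2l b0) mulrBr mulVKf ?gt_eqF//.
    rewrite mulNr opprK => /le_trans; apply.
    rewrite -[X in X * _]gtr0_norm// -nrm_real -nrmZ.
    rewrite scalerBr scalerA -rmorphM /= divff ?gt_eqF// scale1r.
    by rewrite rmorphN /= scaleNr opprK.
Qed.

Lemma real_hahn_banach y : exists u : V -> R,
  [/\ forall x z, u (x + z) = u x + u z, forall (a : R) x, u (a%:C *: x) = a * u x,
      forall x, u x <= nrm x & u y = nrm y].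
Proof.
pose P G := G = set0 \/ (dominated_graph G /\ G (y, nrm y)).
have [|A [PA Amax]] := @Zorn_bigcup _ P.
  move=> F FP Ftot; have [[X [FX X0]]|nF] := pselect (exists X, F X /\ X !=set0).
    right; have good Y p : F Y -> Y p -> dominated_graph Y /\ Y (y, nrm y).
      by move=> /FP[->|].
    have [p0 Xp0] := X0; split; last by exists X => //; have [] := good _ _ FX Xp0.
    split.
    - move=> p q [Y FY Yp] [Z FZ Zq]; have [YZ|ZY] := Ftot _ _ FY FZ.
        by exists Z => //; have [[+ _ _] _] := good _ _ FZ Zq; apply => //; exact: YZ.
      by exists Y => //; have [[+ _ _] _] := good _ _ FY Yp; apply => //; exact: ZY.
    - by move=> a p [Y FY Yp]; exists Y => //; have [[_ + _] _] := good _ _ FY Yp; apply.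
    - by move=> p [Y FY Yp]; have [[_ _ +] _] := good _ _ FY Yp; apply.
  left; rewrite -subset0 => p [X FX Xp]; apply: nF.
  by exists X; split=> //; exists p.
have [gA Ay] : dominated_graph A /\ A (y, nrm y).
  case: PA => // A0; have G0 := dominated_graph_line y.
  have Gy : [set (a%:C *: y, a * nrm y) | a in [set: R]] (y, nrm y).
    by exists 1 => //; rewrite scale1r mul1r.
  have /Amax[] : A `<` [set (a%:C *: y, a * nrm y) | a in [set: R]].
    by split; rewrite A0// => /(_ _ Gy).
  by right.
have [AD AZ Ale] := gA.
have A0 : A (0, 0) by have := AZ 0 _ Ay; rewrite scale0r mul0r.
have /choice[u uA] x0 : exists r, A (x0, r).
  apply: contrapT => /forallNP nA.
  have [t gB] := dominated_graph_extend x0 gA A0.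
  set B := [set _ | _ in _] in gB.
  have AB : A `<=` B.
    move=> p Ap; exists (p, 0) => //=.
    by rewrite scale0r mul0r !addr0; case: (p).
  have /Amax[] : A `<` B.
    split=> // BA; apply: (nA t); apply: BA; exists ((0, 0), 1) => //=.
    by rewrite scale1r mul1r !add0r.
  by right; split=> //; exact: AB.
have Auniq x r s : A (x, r) -> A (x, s) -> r = s.
  have le r' s' : A (x, r') -> A (x, s') -> r' <= s'.
    move=> Ar As; have := Ale _ (AD _ _ Ar (AZ (- 1) _ As)) => /=.
    by rewrite rmorphN /= scaleN1r subrr nrm0 mulN1r subr_le0.
  by move=> Ar As; apply/le_anti/andP; split; exact: le.
exists u; split=> [x z|a x|x|].
- exact: Auniq (uA _) (AD _ _ (uA x) (uA z)).
- exact: Auniq (uA _) (AZ a _ (uA x)).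
- exact: Ale _ (uA x).
- exact: Auniq (uA _) Ay.
Qed.

(** A complex-linear functional is determined by its real part [u] through
    [phi x = u x - i * u (i x)]; the real functional that norms [y] is complexified in this way. *)
Lemma norming_functional y : exists phi : bop V (cplx R),
  (forall x, nrm (phi x) <= nrm x) /\ nrm y <= nrm (phi y).
Proof.
have [u [uD uZ ule uy]] := real_hahn_banach y.
pose phi x : cplx R := u x +i* (- u ('i%C *: x)).
have uC (a b : R) x : u ((a +i* b) *: x) = a * u x + b * u ('i%C *: x).
  rewrite -!uZ -uD scalerA -scalerDl; congr (u (_ *: _)).
  by apply/eqP; rewrite eq_complex /=; apply/andP; split; apply/eqP; ring.
have phiZ (c : R[i]) x : phi (c *: x) = c *: phi x.
  case: c => a b; rewrite /phi (uC a b) scalerA.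
  have -> : 'i%C * (a +i* b) = (- b) +i* a.
    by apply/eqP; rewrite eq_complex /=; apply/andP; split; apply/eqP; ring.
  rewrite (uC (- b) a); set p := u x; set q := u _.
  suff : (a * p + b * q) +i* (- (- b * p + a * q)) = (a +i* b) * (p +i* - q) by [].
  by apply/eqP; rewrite eq_complex /=; apply/andP; split; apply/eqP; ring.
have phiD x z : phi (x + z) = phi x + phi z.
  rewrite /phi scalerDr !uD; move: (u x) (u z) (u ('i%C *: x)) (u ('i%C *: z)) => a b p q.
  suff : (a + b) +i* (- (p + q)) = (a +i* - p) + (b +i* - q) by [].
  by apply/eqP; rewrite eq_complex /=; apply/andP; split; apply/eqP; ring.
have phi_le x : nrm (phi x) <= nrm x.
  have [->|p0] := eqVneq (phi x) 0; first by rewrite nrm0 nrm_ge0.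
  have np : 0 < nrm (phi x).
    by rewrite lt_neqAle nrm_ge0 andbT eq_sym; apply: contraNneq p0 => /nrm0_eq0 ->.
  (* Rotating [x] by [c] makes the value of [phi] real, so that there it agrees with [u], which the
     norm dominates; one factor [nrm (phi x)] then cancels. *)
  pose c : R[i] := (phi x : R[i])^*%C.
  have nc : nrm (c : R[i]^o) = nrm (phi x) by rewrite /nrm normcJ.
  have cE : phi (c *: x) = (nrm (phi x) ^+ 2)%:C.
    by rewrite phiZ rmorphXn /= nrmE sqr_normc mulrC.
  have : u (c *: x) = nrm (phi x) ^+ 2 by have := congr1 (@complex.Re R) cE.
  have := ule (c *: x); rewrite nrmZ nc => + ucx; rewrite ucx expr2.
  by rewrite ler_pM2l.
have phi_lin : linear phi by move=> a x z; rewrite phiD phiZ.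
have phiP : phi \in bop_pred V (cplx R).
  apply/asboolP; split=> //.
  pose L : {linear V -> cplx R} :=
    HB.pack phi (GRing.isLinear.Build R[i] _ _ _ phi phi_lin).
  suff : continuous L by [].
  apply: bounded_linear_continuous; apply/linear_boundedP.
  exists 1; split=> // M M1 x; apply: (@le_trans _ _ (1 * `|x|)); last first.
    by rewrite ler_wpM2r// ltW.
  by rewrite mul1r -(nrmE (L x)) -(nrmE x) lecR; exact: phi_le.
exists (Bop phiP); split=> //; rewrite bopE -uy.
apply: le_trans (nrm_Re _) => /=; exact: ler_norm.
Qed.

End hahn_banach.

(** * Linearization *)

Section linearization.
Context {R : realType} {E : banach R} (U : wopen E) (F : banach R).
Implicit Types (T S : bop (predual U) F).

Lemma hv_comp_subproof (f : U -> F) (Hf : Hv U F f) (phi : bop F (cplx R)) :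
  phi \o f \in @hv_pred R E U (cplx R).
Proof. by apply/asboolP; exact: Hv_comp. Qed.

Definition hv_comp (f : U -> F) (Hf : Hv U F f) (phi : bop F (cplx R)) :
  hv U (cplx R) := HvFun (hv_comp_subproof Hf phi).

(* [y] represents the functional [phi |-> u (phi \o f)] on the dual of [F]. *)
Definition represents (f : U -> F) (Hf : Hv U F f) (u : dual U) (y : F) :=
  forall phi : bop F (cplx R), phi y = u (hv_comp Hf phi).

Section represented.
Variables (f : U -> F) (Hf : Hv U F f).

(** A norming functional [phi] of [y] reduces this to the bound of [u] on [phi \o f]. Uniqueness of
    [y], its existence for limits of functionals and the norm of the linearization all follow from
    this estimate. *)
Lemma represents_bound u y : represents Hf u y -> nrm y <= wnorm f * nrm u.
Proof.
move=> uy; have [phi [phi1 phiy]] := norming_functional y.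
apply: le_trans phiy _; rewrite uy; apply: le_trans (opnormP u _) _.
rewrite nrm_bop mulrC; apply: ler_wpM2r; first exact: opnorm_ge0.
rewrite nrm_hv; apply: wnorm_le; first exact: wnorm_ge0.
move=> x; apply: le_trans (wnormP x Hf).
by apply: ler_wpM2l; [exact/ltW/weight_gt0|exact: phi1].
Qed.

Lemma represents_linear a u v y z : represents Hf u y -> represents Hf v z ->
  represents Hf (a *: u + v) (a *: y + z).
Proof. by move=> uy vz phi; rewrite (bop_linear phi) uy vz. Qed.

Lemma represents_uniq u y z : represents Hf u y -> represents Hf u z -> y = z.
Proof.
move=> uy uz; apply/eqP; rewrite -subr_eq0; apply/eqP/nrm0_eq0/eqP.
rewrite eq_le nrm_ge0 andbT.
have := represents_bound (represents_linear (-1) uz uy).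
by rewrite !scaleN1r addNr nrm0 mulr0 addrC.
Qed.

Lemma represents_dirac x : represents Hf (dirac x) (f x).
Proof. by []. Qed.

Lemma represents_span u : linear_span (range (@dirac _ _ U)) u ->
  exists y, represents Hf u y.
Proof.
move=> [n [c [a [aD ->]]]]; elim: n c a aD => [|n IH] c a aD.
  exists 0 => phi; by rewrite big_ord0 linear0 bop0.
rewrite big_ord_recl; have [x _ <-] := aD ord0.
have [y yP] := IH (fun i => c (lift ord0 i)) _ (fun i => aD (lift ord0 i)).
by exists (c ord0 *: f x + y); apply: represents_linear.
Qed.

Lemma represents_closure u : closure (linear_span (range (@dirac _ _ U))) u ->
  exists y, represents Hf u y.
Proof.
move=> /nrm_closure uP.
(* These sets of vectors representing functionals [e]-close to [u] form a filter base. By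
   [represents_bound] it is Cauchy, and its limit in [F] represents [u]. *)
pose B (e : R) : set F := [set y | exists2 v, represents Hf v y & nrm (u - v) < e].
pose H := filter_from [set e : R | 0 < e] B.
have HF : ProperFilter H.
  apply: filter_from_proper.
    apply: filter_from_filter; first by exists 1; exact: ltr01.
    move=> d e /= d0 e0; exists (Num.min d e); first by rewrite /= lt_min d0.
    by move=> y [v vy]; rewrite lt_min => /andP[vd ve]; split; exists v.
  by move=> e /= /uP[v /represents_span[y vy] uv]; exists y, v.
pose W := wnorm f + 1; have W0 : 0 < W by rewrite ltr_wpDl// wnorm_ge0.
have : cauchy H.
  apply/nrm_cauchy => d d0; pose e := d / (2 * W).
  have e0 : 0 < e by rewrite divr_gt0// mulr_gt0.
  have [v /represents_span[y vy] uv] := uP _ e0; exists y; exists e => //.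
  move=> z [w wz uw] /=.
  have := represents_bound (represents_linear (-1) wz vy).
  rewrite !scaleN1r [- z + y]addrC [- w + v]addrC => /le_lt_trans; apply.
  have vw : nrm (v - w) < 2 * e.
    have -> : v - w = (v - u) + (u - w) by rewrite subrKA.
    by apply: le_lt_trans (nrmD _ _) _; rewrite nrmB; lra.
  apply: (@le_lt_trans _ _ (W * nrm (v - w))).
    by apply: ler_wpM2r; [exact: nrm_ge0|rewrite /W lerDl].
  have -> : d = W * (2 * e) by rewrite /e; field; rewrite gt_eqF.
  by rewrite ltr_pM2l.
move=> /cauchy_cvg/cvg_ex[y /nrm_cvg Hy]; exists y => phi.
apply/eqP; rewrite -subr_eq0; apply/eqP/nrm0_eq0/eqP.
rewrite eq_le nrm_ge0 andbT; apply/ler_addgt0Pr => e e0; rewrite add0r.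
pose k := opnorm phi + nrm (hv_comp Hf phi) + 1.
have n1 := opnorm_ge0 phi; have n2 := nrm_ge0 (hv_comp Hf phi).
have k0 : 0 < k by rewrite /k; lra.
have ek : 0 < e / k by rewrite divr_gt0.
have HB : H (B (e / k)) by exists (e / k).
have [z [/= yz [v vz uv]]] := filter_ex (filterI (Hy _ ek) HB).
have -> : phi y - u (hv_comp Hf phi) =
    phi (y - z) + (v - u) (hv_comp Hf phi).
  by rewrite linearB bopD -vz -[(- u) _]/(- (u _)) subrKA.
have le1 : nrm (phi (y - z)) <= opnorm phi * (e / k).
  by apply: le_trans (opnormP _ _) _; apply: ler_wpM2l => //; exact: ltW.
have le2 : nrm ((v - u) (hv_comp Hf phi)) <= nrm (hv_comp Hf phi) * (e / k).
  apply: le_trans (opnormP _ _) _; rewrite -nrm_bop nrmB mulrC.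
  by apply: ler_wpM2l => //; exact: ltW.
apply: le_trans (nrmD _ _) _; apply: le_trans (lerD le1 le2) _.
rewrite -mulrDl mulrA ler_pdivrMr// mulrC; apply: ler_wpM2l; first exact: ltW.
by rewrite /k lerDl.
Qed.

(** Uniqueness of representatives makes a pointwise choice of them linear, and [represents_bound]
    gives both its continuity and its norm. *)
Lemma linearization_exists : exists2 T : bop (predual U) F,
  T \o @Delta _ _ U = f & nrm T <= wnorm f.
Proof.
have /choice[t tP] (u : predual U) : exists y, represents Hf (val u) y.
  by apply: represents_closure; have /asboolP := cspanP u.
have tlin : linear t.
  move=> a u v; apply: represents_uniq (tP _) _.
  exact: represents_linear (tP u) (tP v).
have tP' : t \in bop_pred (predual U) F.
  apply/asboolP; split=> //.
  pose L : {linear predual U -> F} :=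
    HB.pack t (GRing.isLinear.Build R[i] _ _ _ t tlin).
  suff : continuous L by [].
  apply: bounded_linear_continuous; apply/linear_boundedP.
  exists (wnorm f)%:C; split; first by apply/complex_realP; eexists.
  move=> M fM u; apply: (@le_trans _ _ ((wnorm f)%:C * `|u|)); last first.
    by rewrite ler_wpM2r// ltW.
  rewrite -(nrmE (L u)) -(nrmE u) -rmorphM /= lecR.
  exact: represents_bound (tP u).
exists (Bop tP').
  by apply/funext => x; apply: represents_uniq (tP (Delta x)) _; exact: represents_dirac.
rewrite nrm_bop; apply: opnorm_le; first exact: wnorm_ge0.
by move=> u; exact: represents_bound (tP u).
Qed.

End represented.

(** The difference vanishes on finite combinations of evaluations, which are dense in the
    predual. *)
Lemma predual_ext T S : T \o @Delta _ _ U = S \o @Delta _ _ U -> T = S.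
Proof.
move=> TS; apply/eqP; rewrite -subr_eq0; apply/eqP; set D : bop (predual U) F := T - S.
have DD x : D (Delta x) = 0.
  by rewrite /D bopD -[(- S) _]/(- (S _)) -[T _]/((T \o _) x) TS subrr.
apply: bop_ext => u; rewrite bop0; apply: nrm0_eq0; apply/eqP.
rewrite eq_le nrm_ge0 andbT; apply/ler_addgt0Pr => e e0; rewrite add0r.
have k0 : 0 < opnorm D + 1 by rewrite ltr_wpDl ?opnorm_ge0.
have /asboolP/nrm_closure/(_ _ (divr_gt0 e0 k0))[v [n [c [a [aD vE]]]] uv] := cspanP u.
have /choice[x xE] i : exists x : U, dirac x = a i.
  by have [x _ xa] := aD i; exists x.
pose w : predual U := \sum_(i < n) c i *: Delta (x i).
have wv : val w = v.
  by rewrite vE linear_sum; apply: eq_bigr => i _; rewrite linearZ /= -xE.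
have Dw : D w = 0.
  rewrite /w (linear_sum D) big1// => i _.
  have := bop_linear D (c i) (Delta (x i)) 0.
  by rewrite addr0 linear0 addr0 DD scaler0.
have -> : D u = D (u - w).
  by have := bop_linear D (-1) w u; rewrite Dw scaler0 add0r scaleN1r addrC.
apply: le_trans (opnormP _ _) _; rewrite nrm_cspan linearB /= wv.
apply: (@le_trans _ _ (opnorm D * (e / (opnorm D + 1)))).
  by apply: ler_wpM2l; [exact: opnorm_ge0|exact: ltW].
by rewrite mulrCA ler_piMr ?(ltW e0)// ler_pdivrMr// mul1r lerDl.
Qed.

Lemma linearizationE f T : T \o @Delta _ _ U = f -> linearization f = T.
Proof.
move=> TE; apply: predual_ext; rewrite TE.
by rewrite /linearization; case: xgetP => [S _ //|/(_ T)].
Qed.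

Lemma linearizationK f : Hv U F f -> linearization f \o @Delta _ _ U = f.
Proof. by move=> /linearization_exists[T TE _]; rewrite (linearizationE TE). Qed.

Lemma nrm_linearization f : Hv U F f -> nrm (linearization f) <= wnorm f.
Proof. by move=> /linearization_exists[T TE]; rewrite (linearizationE TE). Qed.

End linearization.

(** * Transfer of the quotient between functions and operators *)

Lemma linearization_comp (R : realType) (E : banach R) (U : wopen E)
    (F G : banach R) (S : bop F G) (f : U -> F) : Hv U F f ->
  linearization (S \o f) = bop_comp S (linearization f).
Proof.
by move=> Hf; apply: linearizationE; rewrite -[in RHS](linearizationK Hf).
Qed.

(** Zero factors through the identity of the scalars with zero on both sides, and the ideal
    inequality bounds its norm. It ensures that the supremum defining a quotient norm is over a
    nonempty set. *)
Lemma op_mem0 (R : realType) (A : op_class R) (F G : banach R) :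
  normed_operator_ideal A ->
  op_mem A (0 : bop F G) /\ (op_norm A (0%R : bop F G) <= 0)%E.
Proof.
move=> AI; have [id_mem _] := oi_id AI.
have [] := oi_comp AI (0 : bop (cplx R) G) (0 : bop F (cplx R)) id_mem.
have -> : bop_comp (0 : bop (cplx R) G) (bop_comp (bop_id (cplx R)) (0 : bop F (cplx R))) = 0.
  exact: bop_ext.
by rewrite nrm0 !mul0e.
Qed.

Theorem corollary2p11 (R : realType) (A I : op_class R) (J : wh_class R) :
  normed_operator_ideal A -> normed_operator_ideal I ->
  normed_wh_ideal J -> linearization_property J I ->
  wh_class_eq (wh_quotient A J) (wh_composition (op_quotient A I)).
Proof.
move=> AI II _ LP E U F f.
have quotient_lin : wh_mem (wh_quotient A J) f ->
    op_mem (op_quotient A I) (linearization f).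
  move=> [Hf fJ] G S AS; rewrite -linearization_comp//.
  by apply/(LP _ _ _ _ (Hv_comp S Hf)).1; exact: fJ.
have normJ (G : banach R) (S : bop F G) : wh_mem (wh_quotient A J) f -> op_mem A S ->
    wh_norm J (S \o f) = op_norm I (bop_comp S (linearization f)).
  move=> [Hf fJ] AS; rewrite (LP _ _ _ _ (Hv_comp S Hf)).2; last exact: fJ.
  by rewrite linearization_comp.
have comp_quotient (G H : banach R) (T : bop G F) (g : U -> G) (S : bop F H) :
    op_mem (op_quotient A I) T -> Hv U G g -> f = T \o g -> op_mem A S ->
    op_mem I (linearization (S \o f)) /\
    (op_norm I (linearization (S \o f)) <=
       op_norm I (bop_comp S T) * (wnorm g)%:E)%E.
  move=> TQ Hg -> AS.
  (* The identity of [H] fills the left factor in the two-sided ideal inequality. Its norm is only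
     bounded by 1, being 0 when [H] is trivial. *)
  have -> : linearization (S \o (T \o g)) =
      bop_comp (bop_id H) (bop_comp (bop_comp S T) (linearization g)).
    rewrite linearization_comp; last exact: Hv_comp.
    by rewrite linearization_comp//; exact: bop_ext.
  have ST := TQ _ _ AS.
  have [? le1] := oi_comp II (bop_id H) (linearization g) ST; split=> //.
  have /andP[ST0 _] := oi_norm_fin II ST.
  apply: le_trans le1 _; rewrite -muleA.
  have q0 : (0 <= op_norm I (bop_comp S T) * (nrm (linearization g))%:E)%E.
    by rewrite mule_ge0// lee_fin nrm_ge0.
  apply: (@le_trans _ _ (1 * (op_norm I (bop_comp S T) * (nrm (linearization g))%:E))%E).
    apply: lee_wpmul2r => //; rewrite lee_fin nrm_bop.
    by apply: opnorm_le => // x; rewrite mul1r.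
  by rewrite mul1e lee_wpmul2l// lee_fin nrm_linearization.
split; last move=> fQ.
  split=> [fQ|[G [T [g [TQ Hg fE]]]]].
    exists (predual U), (linearization f), (@Delta _ _ U).
    by split; [exact: quotient_lin|exact: Hv_Delta|rewrite linearizationK//; case: fQ].
  have Hf : Hv U F f by rewrite fE; exact: Hv_comp.
  split=> // H S AS; apply/(LP _ _ _ _ (Hv_comp S Hf)).1.
  by have [] := comp_quotient _ _ _ _ _ TQ Hg fE AS.
have [Hf fJ] := fQ; apply/eqP; rewrite eq_le; apply/andP; split.
  (* For a fixed factorization, each term of the supremum is at most the norm of [S \o T] times
     [wnorm g], and the former is a term of the quotient norm of [T]. *)
  apply: le_ereal_inf_tmp => _ [G [T [g [TQ Hg fE ->]]]].
  apply: ge_ereal_sup => _ [H [S [AS S1 ->]]].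
  rewrite normJ// -linearization_comp//.
  apply: le_trans (comp_quotient _ _ _ _ _ TQ Hg fE AS).2 _.
  apply: lee_wpmul2r; first by rewrite lee_fin wnorm_ge0.
  by apply: ereal_sup_ubound; exists H, S.
have -> : wh_norm (wh_quotient A J) f = op_norm (op_quotient A I) (linearization f).
  congr ereal_sup; apply/seteqP; split=> _ [G [S [AS S1 ->]]]; exists G, S;
  by split=> //; rewrite normJ.
apply: (@le_trans _ _ (op_norm (op_quotient A I) (linearization f) *
    (wnorm (@Delta _ _ U))%:E)%E).
  apply: ereal_inf_lbound; exists (predual U), (linearization f), (@Delta _ _ U).
  by split=> //; [exact: quotient_lin|exact: Hv_Delta|rewrite linearizationK].
have [A0 A0le] := op_mem0 F F AI.
(* The inequality [wnorm Delta <= 1], strict for instance when [U] is empty, is to be multiplied by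
   this possibly infinite supremum. Its nonnegativity comes from the term of the zero operator. *)
have Tf0 : (0 <= op_norm (op_quotient A I) (linearization f))%E.
  apply: (@le_trans _ _ (op_norm I (bop_comp (0%R : bop F F) (linearization f)))).
    by have /andP[] := oi_norm_fin II (quotient_lin fQ _ _ A0).
  apply: ereal_sup_ubound; exists F, 0; split=> //.
  by apply: le_trans A0le _; rewrite lee_fin.
rewrite -[leRHS]mule1; apply: lee_wpmul2l => //; rewrite lee_fin.
exact: wnorm_Delta.
Qed.
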